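(* Let $\mathbb{A}$ be any set of allowable test processes. Consider any path $\omega\in\Omega$ and any interval forecast $I=[\underline{p},\overline{p}]\in\mathcal{I}$ such that $\omega$ is $\mathbb{A}$-random for the stationary forecasting system $\gamma_I$. Then for any recursive selection function $\sigma\colon\mathbb{N}\to\{0,1\}$ such that $\lim_{n\to\infty}\sum_{k=1}^{n}\sigma(k)=\infty$: $$\underline{p}\le\liminf_{n\to\infty}\frac{\sum_{k=1}^{n}\sigma(k)\,\omega_{k}}{\sum_{k=1}^{n}\sigma(k)}\le\limsup_{n\to\infty}\frac{\sum_{k=1}^{n}\sigma(k)\,\omega_{k}}{\sum_{k=1}^{n}\sigma(k)}\le\overline{p}.$$ The same conclusion continues to hold when (instead) $\omega$ is Schnorr random for $\gamma_I$.
   Context: Notation: $\mathbb{N}=\{1,2,\dots\}$, $\mathbb{N}_0=\mathbb{N}\cup\{0\}$. Situations are the finite binary sequences $\mathbb{S}=\bigcup_{n\in\mathbb{N}_0}\{0,1\}^n$, with $\square$ the empty sequence; $sx$ is $s$ with $x\in\{0,1\}$ appended. Paths are elements $\omega$ of $\Omega=\{0,1\}^{\mathbb{N}}$, with $n$-th entry $\omega_n$; $\omega_{1:n}\in\mathbb{S}$ consists of the first $n$ entries. $\mathcal{I}$ is the set of non-empty closed subintervals of $[0,1]$. For $f\colon\{0,1\}\to\mathbb{R}$ and $I\in\mathcal{I}$, $\overline{E}_I(f)=\max_{p\in I}[pf(1)+(1-p)f(0)]$. A forecasting system is a map $\varphi\colon\mathbb{S}\to\mathcal{I}$. For $I\in\mathcal{I}$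 (not assumed computable), the stationary forecasting system $\gamma_I$ is given by $\gamma_I(s)=I$ for all $s\in\mathbb{S}$. A selection function is a map $\sigma\colon\mathbb{N}\to\{0,1\}$. A real process is a map $F\colon\mathbb{S}\to\mathbb{R}$, with $\Delta F(s)(x)=F(sx)-F(s)$. A test process is a non-negative real process with $F(\square)=1$. A supermartingale for $\varphi$ is a real process $M$ with $\overline{E}_{\varphi(s)}(\Delta M(s))\le 0$ for all $s\in\mathbb{S}$; a test supermartingale for $\varphi$ is a test process that is a supermartingale for $\varphi$. Computability: ''recursive'' means computable by a Turing machine (countable sets such as $\mathbb{S}$ and $\mathbb{S}\times\mathbb{N}_0$ are identified with $\mathbb{N}_0$ by recursive bijections with recursive inverse). A real process $F$ is computable if there are a recursive family of rationals $r_{s,n}$ and a recursive map $e\colon\mathbb{S}\times\mathbb{N}_0\to\mathbb{N}_0$ such that $n\ge e(s,N)$ implies $|r_{s,n}-F(s)|\le 2^{-N}$. A set of allowable test processes is any countable set $\mathbb{A}$ of test processes that contains all computable (strictly) positive test processes. A path $\omega$ is $\mathbb{A}$-random for $\varphi$ if $\sup_{n\in\mathbb{N}}T(\omega_{1:n})<\infty$ for every $T\in\mathbb{A}$ that is a test supermartingale for $\varphi$. A growth function is a recursive, non-decreasing, unbounded map $\rho\colon\mathbb{N}_0\to\mathbb{N}_0$. A path $\omega$ is Schnorr random for $\varphi$ if $\limsup_{n\to\infty}[T(\omega_{1:n})-\rho(n)]\le 0$ for all computable test supermartingales $T$ for $\varphi$ and all growth functions $\rho$. *)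

(* Defs.v *)
From mathcomp Require Import all_boot all_order all_algebra.
From mathcomp Require Import all_classical all_reals all_analysis.
Import Order.TTheory GRing.Theory Num.Theory.
Import numFieldNormedType.Exports.

Set Implicit Arguments.
Unset Strict Implicit.
Unset Printing Implicit Defensive.

Local Open Scope classical_set_scope.
Local Open Scope ring_scope.

Inductive move := MoveL | MoveN | MoveR.

(** Deterministic machines with [tm_aux.+1] two-way infinite tapes.
    [tm_trans q a] gives the next state and, for each tape, the symbol to write
    and the head move, when the scanned symbols are [a]. *)
Record turing_machine := TuringMachine {
  tm_aux : nat;
  tm_state : finType;
  tm_symbol : finType;
  tm_blank : tm_symbol;
  tm_mark : tm_symbol;
  tm_markP : tm_mark != tm_blank;
  tm_start : tm_state;
  tm_halt : pred tm_state;
  tm_trans : tm_state -> {ffun 'I_tm_aux.+1 -> tm_symbol} ->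
             tm_state * ('I_tm_aux.+1 -> tm_symbol * move) }.

Section Machine.
Variable M : turing_machine.

Record configuration := Configuration {
  cf_state : tm_state M;
  cf_tape : 'I_(tm_aux M).+1 -> int -> tm_symbol M;
  cf_head : 'I_(tm_aux M).+1 -> int }.

Definition move_head (d : move) (z : int) : int :=
  match d with MoveL => z - 1 | MoveN => z | MoveR => z + 1 end.

Definition tm_step (c : configuration) : configuration :=
  if tm_halt (cf_state c) then c else
  let qa := tm_trans (cf_state c) [ffun i => cf_tape c i (cf_head c i)] in
  Configuration qa.1
    (fun i z => if z == cf_head c i then (qa.2 i).1 else cf_tape c i z)
    (fun i => move_head (qa.2 i).2 (cf_head c i)).

Definition blank_tape (z : int) : tm_symbol M := tm_blank M.

Definition unary_tape (n : nat) (z : int) : tm_symbol M :=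
  if 0 <= z < n%:Z then tm_mark M else tm_blank M.

Definition tm_init (n : nat) : configuration :=
  Configuration (tm_start M)
    (fun i => if i == ord0 then unary_tape n else blank_tape) (fun=> 0).

(** Input and output are in unary on the first tape. *)
Definition tm_computes (f : nat -> nat) : Prop :=
  forall n, exists t, let c := iter t tm_step (tm_init n) in
    tm_halt (cf_state c) /\ (forall z, cf_tape c ord0 z = unary_tape (f n) z).

End Machine.

Definition recursive (f : nat -> nat) : Prop := exists M, tm_computes M f.

Definition situation := seq bool.

(** Sequences indexed by the positive integers are shifted to start at 0:
    [w k] is the entry with index k + 1. *)
Definition bitpath := nat -> bool.
Definition selection := nat -> bool.

Definition prefix_of (w : bitpath) (n : nat) : situation := mkseq w n.

(** Codes of situations: the empty sequence, 0, 1, 00, 01, 10, 11, 000, ...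
    are numbered 0, 1, 2, 3, ... *)
Definition code_situation (s : situation) : nat :=
  foldl (fun c (x : bool) => c.*2 + x.+1)%N 0%N s.

(** Cantor's pairing function. *)
Definition code_pair (a b : nat) : nat := ('C((a + b).+1, 2) + b)%N.

Lemma code_situation_bij : bijective code_situation.
Proof.
have codeS s x : code_situation (rcons s x) = ((code_situation s).*2 + x.+1)%N.
  by rewrite /code_situation -cats1 foldl_cat.
have inj : injective code_situation.
  elim/last_ind => [|s x IH] t; case/lastP: t => [|t y] //; rewrite ?codeS.
  - by rewrite addnS.
  - by rewrite addnS.
  rewrite !addnS => -[] E.
  have xy : x = y.
    by have := congr1 odd E; rewrite !oddD !odd_double !oddb.
  by move: E; rewrite xy => /addIn /double_inj /IH ->.
have surj n : exists s, code_situation s == n.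
  elim/ltn_ind: n => -[|n] IH; first by exists [::].
  have lt_n : (n./2 < n.+1)%N.
    by rewrite ltnS -{2}(odd_double_half n) -addnn addnA leq_addl.
  have [s /eqP Es] := IH _ lt_n.
  exists (rcons s (odd n)).
  by rewrite codeS Es addnS addnC odd_double_half.
exists (fun n => xchoose (surj n)) => [s|n]; last exact/eqP/(xchooseP (surj n)).
exact/inj/eqP/(xchooseP (surj _)).
Qed.

Lemma code_pair_bij : bijective (fun p : nat * nat => code_pair p.1 p.2).
Proof.
have lt_code a b c d : (a + b < c + d)%N -> (code_pair a b < code_pair c d)%N.
  move=> lt; rewrite /code_pair; apply: leq_trans (leq_addr _ _).
  apply: leq_trans (leq_bin2l 2 (lt : ((a + b).+2 <= (c + d).+1)%N)).
  by rewrite [X in (_ < X)%N]binS bin1 ltn_add2l ltnS leq_addl.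
have inj : injective (fun p : nat * nat => code_pair p.1 p.2).
  move=> [a b] [c d] /= E.
  have Es : (a + b = c + d)%N.
    by case: (ltngtP (a + b) (c + d)) => // /lt_code; rewrite E ltnn.
  move: E; rewrite /code_pair Es => /addnI bd.
  by move: Es; rewrite bd => /addIn ->.
have surj n : exists p : nat * nat, code_pair p.1 p.2 == n.
  elim: n => [|n [[a b] /= /eqP <-]]; first by exists (0, 0)%N.
  case: a => [|a]; last first.
    by exists (a, b.+1); rewrite /code_pair /= addSnnS addnS.
  exists (b.+1, 0)%N; rewrite /code_pair /= !addn0 add0n.
  by rewrite [X in X == _]binS bin1 addnS.
exists (fun n => xchoose (surj n)) => [p|n]; last exact/eqP/(xchooseP (surj n)).
exact/inj/eqP/(xchooseP (surj _)).
Qed.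

Definition recursive_family (f : situation -> nat -> nat) : Prop :=
  exists2 g, recursive g
    & forall s n, f s n = g (code_pair (code_situation s) n).

Definition recursive_rat_family (r : situation -> nat -> rat) : Prop :=
  exists a b c : situation -> nat -> nat,
    [/\ recursive_family a, recursive_family b, recursive_family c,
        forall s n, (0 < b s n)%N
      & forall s n, r s n = (-1) ^+ c s n * ((a s n)%:R / (b s n)%:R)].

Definition recursive_selection (sigma : selection) : Prop :=
  recursive (fun k => sigma k : nat).

Definition growth_function (rho : nat -> nat) : Prop :=
  [/\ recursive rho,
      {homo rho : m n / (m <= n)%N}
    & forall B, exists n, (B < rho n)%N].

Section Randomness.
Variable R : realType.

Record interval_forecast := IntervalForecast {
  lower : R;
  upper : R;
  interval_forecastP : [&& 0 <= lower, lower <= upper & upper <= 1] }.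

(** The supremum is a maximum: an affine function on a compact interval. *)
Definition upper_expectation (I : interval_forecast) (f : bool -> R) : R :=
  sup [set p * f true + (1 - p) * f false | p in `[lower I, upper I]].

Definition forecasting_system := situation -> interval_forecast.

Definition stationary (I : interval_forecast) : forecasting_system := fun=> I.

Definition real_process := situation -> R.

Definition process_diff (F : real_process) (s : situation) (x : bool) : R :=
  F (rcons s x) - F s.

Definition test_process (F : real_process) : Prop :=
  (forall s, 0 <= F s) /\ F [::] = 1.

Definition supermartingale (phi : forecasting_system) (M : real_process) :
    Prop :=
  forall s, upper_expectation (phi s) (process_diff M s) <= 0.

Definition test_supermartingale (phi : forecasting_system)
    (T : real_process) : Prop :=
  test_process T /\ supermartingale phi T.

Definition computable_process (F : real_process) : Prop :=
  exists (r : situation -> nat -> rat) (e : situation -> nat -> nat),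
    [/\ recursive_rat_family r, recursive_family e
      & forall s N n, (e s N <= n)%N -> `|ratr (r s n) - F s| <= 2 ^- N].

Definition allowable (A : set real_process) : Prop :=
  [/\ countable A,
      forall F, A F -> test_process F
    & forall F, test_process F -> computable_process F ->
        (forall s, 0 < F s) -> A F].

Definition allowable_random (A : set real_process) (phi : forecasting_system)
    (w : bitpath) : Prop :=
  forall T, A T -> test_supermartingale phi T ->
    (ereal_sup [set (T (prefix_of w n))%:E | n in [set n | (0 < n)%N]]
       < +oo)%E.

Definition schnorr_random (phi : forecasting_system) (w : bitpath) : Prop :=
  forall T rho, test_supermartingale phi T -> computable_process T ->
    growth_function rho ->
    (limn_esup (fun n => (T (prefix_of w n) - (rho n)%:R)%:E) <= 0)%E.

Definition selected_count (sigma : selection) (n : nat) : R :=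
  \sum_(0 <= k < n) (sigma k)%:R.

(** Division by zero gives 0 as long as nothing has been selected. *)
Definition selected_frequency (sigma : selection) (w : bitpath) (n : nat) : R :=
  (\sum_(0 <= k < n) (sigma k)%:R * (w k)%:R) / selected_count sigma n.

End Randomness.

(* Main.v *)
Require Import Defs.
From mathcomp Require Import all_boot all_order all_algebra.
From mathcomp Require Import all_classical all_reals all_analysis.
From mathcomp Require Import zify ring lra.
Import Order.TTheory GRing.Theory Num.Theory.
Import numFieldNormedType.Exports.
Local Open Scope classical_set_scope.
Local Open Scope ring_scope.

Set Implicit Arguments.
Unset Strict Implicit.
Unset Printing Implicit Defensive.

(** If [u / d < v / d < r] and the outcome [x] has upper probability at most
    [u / d], then betting on the selected entries with the likelihood ratio of
    [v / d] against [u / d] is a rational-valued supermartingale, and it grows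
    exponentially in the number of selected entries along every stretch where
    the frequency of [x] is at least [r].  An allowable-random path keeps it
    bounded, and a Schnorr-random path keeps it below the number of selected
    entries, which is itself a growth function; so the frequency of [x] is
    eventually at most [r].  Applied to both outcomes, this bounds the limit
    superior and the limit inferior.

    That the capital and the selection count are recursive is shown with
    register programs compiled to multi-tape machines.  The machine computing
    the selection function is called as a subroutine: the cells it visits are
    recorded, so its tapes can be erased after each call. *)

(** * Tape programs and their translation to Turing machines *)

Definition upd (J : eqType) (X : Type) (T : J -> X) (j : J) (x : X) : J -> X :=
  fun i => if i == j then x else T i.

Section TapePrograms.
Variables J S : finType.

Definition tape := ((int -> S) * int)%type.
Definition scan (t : tape) : S := t.1 t.2.
Definition act1 (a : S * move) (t : tape) : tape :=
  (fun z => if z == t.2 then a.1 else t.1 z, move_head a.2 t.2).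
Definition act (a : J -> S * move) (T : J -> tape) : J -> tape :=
  fun j => act1 (a j) (T j).

Lemma act1_id t : act1 (scan t, MoveN) t = t.
Proof.
case: t => t h; congr pair; apply/funext => z /=.
by case: eqP => // ->.
Qed.

(** A transition to [None] leaves the program. *)
Record prog := Prog {
  pst : finType;
  pstart : pst;
  ptr : pst -> (J -> S) -> option pst * (J -> S * move) }.

Definition pstep P (c : option (pst P) * (J -> tape)) :=
  if c.1 is Some q then
    let qa := ptr q (fun j => scan (c.2 j)) in (qa.1, act qa.2 c.2)
  else c.

Inductive reach P :
    option (pst P) * (J -> tape) -> option (pst P) * (J -> tape) -> Prop :=
| reach_refl c : reach c c
| reach_step q T c : reach (pstep (Some q, T)) c -> reach (Some q, T) c.

Lemma reach_trans P (c1 c2 c3 : option (pst P) * (J -> tape)) :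
  reach c1 c2 -> reach c2 c3 -> reach c1 c3.
Proof.
by move=> c12 c23; elim: c12 c23 => // q T c _ IH /IH; exact: reach_step.
Qed.

Lemma reach_iter P (c c' : option (pst P) * (J -> tape)) :
  reach c c' -> exists n, iter n (@pstep P) c = c'.
Proof.
elim=> [{}c|q T {}c' _ [n <-]]; first by exists 0.
by exists n.+1; rewrite iterSr.
Qed.

Definition exec P T T' := reach (Some (pstart P), T) (None, T').

(** Each combinator below runs a component inside a larger program. Here [k] renames the states of
    the component and [h] also redirects its exit, so one simulation argument serves all of them. *)
Lemma reach_embed P Q (k : pst P -> pst Q)
    (h : option (pst P) -> option (pst Q))
    o T o' T' :
  (forall q, h (Some q) = Some (k q)) ->
  (forall q a, ptr (k q) a = (h (ptr q a).1, (ptr q a).2)) ->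
  reach (o, T) (o', T') -> reach (h o, T) (h o', T').
Proof.
move=> hk tr.
suff sub c c' : reach c c' -> reach (h c.1, c.2) (h c'.1, c'.2) by exact: sub.
elim=> [{}c|q {}T {}c' _]; first exact: reach_refl.
rewrite /pstep /= => IH; rewrite hk; apply: reach_step.
by rewrite /pstep /= tr.
Qed.

Definition basic (g : (J -> S) -> J -> S * move) : prog :=
  @Prog unit tt (fun _ a => (None, g a)).

Lemma exec_basic g T : exec (basic g) T (act (g (fun j => scan (T j))) T).
Proof. by apply: reach_step; exact: reach_refl. Qed.

Definition seqp (P Q : prog) : prog :=
  @Prog (pst P + pst Q)%type (inl (pstart P)) (fun q a =>
    match q with
    | inl q => ((if (ptr q a).1 is Some q' then Some (inl q')
                 else Some (inr (pstart Q))), (ptr q a).2)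
    | inr q => (omap inr (ptr q a).1, (ptr q a).2)
    end).

Lemma exec_seq P Q T1 T2 T3 :
  exec P T1 T2 -> exec Q T2 T3 -> exec (seqp P Q) T1 T3.
Proof.
move=> PT QT; apply: (@reach_trans (seqp P Q) _ (Some (inr (pstart Q)), T2)).
  exact: (@reach_embed P (seqp P Q) inl (fun o => if o is Some q
    then Some (inl q) else Some (inr (pstart Q))) _ _ _ _ _ _ PT).
exact: (@reach_embed Q (seqp P Q) inr (omap inr) _ _ _ _ _ _ QT).
Qed.

Definition ifp (b : (J -> S) -> bool) (P Q : prog) : prog :=
  @Prog (option (pst P + pst Q)) None (fun q a =>
    match q with
    | None => (Some (Some (if b a then inl (pstart P) else inr (pstart Q))),
               fun j => (a j, MoveN))
    | Some (inl q) => (omap (Some \o inl) (ptr q a).1, (ptr q a).2)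
    | Some (inr q) => (omap (Some \o inr) (ptr q a).1, (ptr q a).2)
    end).

Lemma act_id (T : J -> tape) : act (fun j => (scan (T j), MoveN)) T = T.
Proof. by apply/funext => j; rewrite /act act1_id. Qed.

Lemma exec_if b P Q T T' :
  (if b (fun j => scan (T j)) then exec P T T' else exec Q T T') ->
  exec (ifp b P Q) T T'.
Proof.
move=> PQ; apply: reach_step; rewrite /pstep /= act_id.
case: ifP PQ => _ H.
  exact: (@reach_embed P (ifp b P Q) (Some \o inl) (omap (Some \o inl))
            _ _ _ _ _ _ H).
exact: (@reach_embed Q (ifp b P Q) (Some \o inr) (omap (Some \o inr))
            _ _ _ _ _ _ H).
Qed.

(** The state [None] tests the guard. As the exit of [P] is also written [None], wrapping the next
    state of [P] in [Some] sends every exit of the body back to the test. *)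
Definition whilep (b : (J -> S) -> bool) (P : prog) : prog :=
  @Prog (option (pst P)) None (fun q a =>
    match q with
    | None => ((if b a then Some (Some (pstart P)) else None),
               fun j => (a j, MoveN))
    | Some q => (Some (ptr q a).1, (ptr q a).2)
    end).

(** Loops are verified through a closed form: [g k] describes all tapes after [k] rounds. *)
Lemma exec_while (b : (J -> S) -> bool) P (g : nat -> J -> tape) n :
  (forall k, (k < n)%N ->
     b (fun j => scan (g k j)) /\ exec P (g k) (g k.+1)) ->
  ~~ b (fun j => scan (g n j)) ->
  exec (whilep b P) (g 0%N) (g n).
Proof.
elim: n g => [|n IH] g gS gn.
  apply: reach_step; rewrite /pstep /= act_id (negbTE gn); exact: reach_refl.
have [b0 P0] := gS 0%N isT.
apply: reach_step; rewrite /pstep /= act_id b0.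
apply: (@reach_trans (whilep b P) _ (Some None, g 1%N)).
  exact: (@reach_embed P (whilep b P) Some Some _ _ _ _ _ _ P0).
by apply: (IH (g \o succn)) => // k kn; exact: gS.
Qed.

End TapePrograms.

(** * Tape programs as Turing machines *)

Section ToTuringMachine.
Variables (J S : finType) (blank mark : S) (mark_blank : mark != blank).

Definition unary (n : nat) (z : int) : S :=
  if 0 <= z < n%:Z then mark else blank.

(** The tape [None] is used for input and output. *)
Definition start_tapes (n : nat) (j : option J) : tape S :=
  if j is Some _ then (fun=> blank, 0) else (unary n, 0).

(** The tape [None] has to become tape 0, where a machine finds its input and leaves its output. *)
Let tape_of (i : 'I_(#|J|.+1)) : option J := omap enum_val (unlift ord0 i).
Let index_of (j : option J) : 'I_(#|J|.+1) :=
  if j is Some j then lift ord0 (enum_rank j) else ord0.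

Let index_ofK : cancel index_of tape_of.
Proof.
by case=> [j|]; rewrite /tape_of /= ?liftK ?unlift_none //= enum_rankK.
Qed.

Let tape_of0 i : (i == ord0) = (tape_of i == None).
Proof. by rewrite /tape_of; case: unliftP => [j ->|->]. Qed.

Let machine (P : prog (option J) S) : turing_machine :=
  @TuringMachine #|J| (option (pst P)) S blank mark mark_blank
    (Some (pstart P)) (fun q => ~~ isSome q)
    (fun q a => if q is Some q then
       let qa := ptr q (fun j => a (index_of j)) in
       (qa.1, fun i => qa.2 (tape_of i))
     else (None, fun i => (a i, MoveN))).

Let conf P (c : option (pst P) * (option J -> tape S)) :
    configuration (machine P) :=
  @Configuration (machine P) c.1
    (fun i => (c.2 (tape_of i)).1) (fun i => (c.2 (tape_of i)).2).

Let step_conf P c : tm_step (@conf P c) = conf (pstep c).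
Proof.
case: c => -[q|] T //; rewrite /tm_step /conf /pstep /=.
set a := (fun j => _).
have -> // : a = (fun j => scan (T j)).
by apply/funext => j; rewrite /a ffunE index_ofK.
Qed.

Lemma recursive_exec (P : prog (option J) S) g :
  (forall n, exists2 T, exec P (start_tapes n) T & (T None).1 = unary (g n)) ->
  recursive g.
Proof.
move=> PT; exists (machine P) => n.
have [T /reach_iter [t tT] Tg] := PT n.
exists t.
have -> : tm_init (machine P) n = conf (Some (pstart P), start_tapes n).
  rewrite /tm_init /conf /=; congr Configuration; apply/funext => i.
    rewrite tape_of0; by case: (tape_of i).
  by case: (tape_of i).
have -> m c : iter m (@tm_step _) (@conf P c) = conf (iter m (@pstep _ _ P) c).
  by elim: m => //= m ->; rewrite step_conf.
rewrite tT /=; split=> // z.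
have -> : tape_of ord0 = None by apply/eqP; rewrite -tape_of0.
by rewrite Tg.
Qed.

End ToTuringMachine.

(** * Register programs *)

Lemma updC (J : eqType) (X : Type) (T : J -> X) i j x y : i != j ->
  upd (upd T i x) j y = upd (upd T j y) i x.
Proof.
move=> ij; apply/funext => k; rewrite /upd.
by case: eqP => // ->; rewrite eq_sym (negbTE ij).
Qed.

Lemma upd_upd (J : eqType) (X : Type) (T : J -> X) i x y :
  upd (upd T i x) i y = upd T i y.
Proof. by apply/funext => k; rewrite /upd; case: eqP. Qed.

Lemma upd_self (J : eqType) (X : Type) (T : J -> X) i : upd T i (T i) = T.
Proof. by apply/funext => k; rewrite /upd; case: eqP => // ->. Qed.

Lemma upd_same (J : eqType) (X : Type) (T : J -> X) i x : upd T i x i = x.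
Proof. by rewrite /upd eqxx. Qed.

Lemma upd_diff (J : eqType) (X : Type) (T : J -> X) i j x :
  j != i -> upd T i x j = T j.
Proof. by rewrite /upd => /negbTE ->. Qed.

Lemma act_upd (J S : finType) (T : J -> tape S) (g : J -> S * move) j a :
  act (upd g j a) T = upd (act g T) j (act1 a (T j)).
Proof. by apply/funext => i; rewrite /act /upd; case: eqP => // ->. Qed.

Lemma act1_move (S : finType) (t : tape S) d :
  act1 (scan t, d) t = (t.1, move_head d t.2).
Proof.
case: t => t h; congr pair; apply/funext => z /=.
by case: eqP => // ->.
Qed.

Lemma count_interval (l off : int) (n p : nat) :
  l <= off -> off + p%:Z <= l + n%:Z ->
  (\sum_(0 <= m < n) ((off <= l + m%:Z < off + p%:Z)%R : nat) = p)%N.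
Proof.
move=> lo on; pose a := `|off - l|%N.
(* This form holds for every [n], so the induction can drop the hypothesis that the block fits. *)
suff -> : (\sum_(0 <= m < n) ((off <= l + m%:Z < off + p%:Z)%R : nat) =
    minn n (a + p) - minn n a)%N by lia.
elim: n {on} => [|n IH]; first by rewrite big_geq // !min0n.
by rewrite big_nat_recr //= IH; case: (boolP (off <= _ < _)) => /=; lia.
Qed.

Section RegisterPrograms.
Variables (K : nat) (M : turing_machine) (f : nat -> nat).
Hypothesis M_f : tm_computes M f.

(** The tapes are one for input and output, one per register and one per tape of [M]. The symbol
    [None] stands for an empty cell, distinct from the blank [Some (tm_blank M)]; this distinction
    records which cells a call has used. *)
Local Notation k := (tm_aux M).+1.
Local Notation J := (option ('I_K + 'I_k)).
Local Notation S := (option (tm_symbol M)).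
Local Notation mark := (Some (tm_mark M)).
Local Notation program := (prog J S).

Let R (v : 'I_K) : J := Some (inl v).
Let W (i : 'I_k) : J := Some (inr i).

(** A register is the position of the head, counted from a marked cell. *)
Definition regtape (n : nat) : tape S :=
  (fun z => if z == 0 then mark else None, n%:Z).

(** The tapes of [M] must be empty, but their heads may be anywhere, since a call leaves them where
    its erasing loop stops. *)
Definition Rep (s : 'I_K -> nat) (T : J -> tape S) : Prop :=
  (forall v, T (R v) = regtape (s v)) /\ forall i z, (T (W i)).1 z = None.

Variant runs (P : program) s s' : Prop :=
  Runs of forall T, Rep s T ->
    exists T', [/\ exec P T T', Rep s' T' & T' None = T None].

Let still (a : J -> S) : J -> S * move := fun j => (a j, MoveN).

Definition one (j : J) (g : S -> S * move) : program :=
  basic (fun a => upd (still a) j (g (a j))).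

Lemma exec_one j g (T : J -> tape S) :
  exec (one j g) T (upd T j (act1 (g (scan (T j))) (T j))).
Proof.
have := exec_basic (fun a => upd (still a) j (g (a j))) T.
by rewrite act_upd act_id.
Qed.

Lemma scan_regtape n : scan (regtape n) = if n == 0%N then mark else None.
Proof. by case: n. Qed.

Lemma Rep_upd s T v n : Rep s T -> Rep (upd s v n) (upd T (R v) (regtape n)).
Proof.
case=> TR TW; split=> [u|i z]; last by rewrite upd_diff.
have [->|uv] := eqVneq u v; first by rewrite !upd_same.
rewrite !upd_diff //; apply: contra uv => /eqP[->]; exact: eqxx.
Qed.

Definition inc v := one (R v) (fun x => (x, MoveR)).
Definition dec v :=
  one (R v) (fun x => (x, if x == mark then MoveN else MoveL)).
Definition nonzero v (a : J -> S) : bool := a (R v) != mark.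

Lemma runs_inc v s : runs (inc v) s (upd s v (s v).+1).
Proof.
split=> T sT; have [TR _] := sT.
exists (upd T (R v) (regtape (s v).+1)); split=> //; last exact: Rep_upd.
have := exec_one (R v) (fun x => (x, MoveR)) T.
by rewrite act1_move TR /regtape /= -(addn1 (s v)) PoszD.
Qed.

Lemma runs_dec v s : runs (dec v) s (upd s v (s v).-1).
Proof.
split=> T sT; have [TR _] := sT.
exists (upd T (R v) (regtape (s v).-1)); split=> //; last exact: Rep_upd.
have := exec_one (R v) (fun x => (x, if x == mark then MoveN else MoveL)) T.
rewrite act1_move TR scan_regtape; case: (s v) => [|n] /=; rewrite ?eqxx //.
by rewrite -(addn1 n) PoszD addrK.
Qed.

Lemma nonzeroE v s T : Rep s T ->
  nonzero v (fun j => scan (T j)) = (s v != 0%N).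
Proof.
case=> TR _; rewrite /nonzero TR scan_regtape.
by case: (s v) => //=; rewrite eqxx.
Qed.

Definition skip : program := basic still.

Lemma runs_skip s : runs skip s s.
Proof.
split=> T sT; exists T; split=> //.
by have := exec_basic still T; rewrite act_id.
Qed.

Lemma runs_seq P Q s1 s2 s3 :
  runs P s1 s2 -> runs Q s2 s3 -> runs (seqp P Q) s1 s3.
Proof.
move=> [P12] [Q23]; split=> T1 /P12 [T2 [e12 /Q23 [T3 [e23 r3 n3]] n2]].
exists T3; split=> //; [exact: exec_seq e12 e23 | by rewrite n3].
Qed.

Lemma runs_if v P Q s s' :
  (if s v != 0%N then runs P s s' else runs Q s s') ->
  runs (ifp (nonzero v) P Q) s s'.
Proof.
move=> PQ; split=> T sT; have nz := nonzeroE v sT.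
case: ifP PQ => sv [/(_ T sT) [T' [e r n]]]; exists T'; split=> //;
  by apply: exec_if; rewrite nz sv.
Qed.

(** The tapes reached by a round are only known to exist, so the rounds are composed one at a time
    instead of giving [exec_while] a family of tapes. *)
Lemma runs_while v P (g : nat -> 'I_K -> nat) n :
  (forall m, (m < n)%N -> g m v != 0%N /\ runs P (g m) (g m.+1)) ->
  g n v = 0%N ->
  runs (whilep (nonzero v) P) (g 0%N) (g n).
Proof.
elim: n g => [|n IH] g gS gn; split=> T gT.
  exists T; split=> //.
  by apply: (@exec_while _ _ _ _ (fun=> T) 0) => //; rewrite (nonzeroE _ gT) gn.
have [g0 [/(_ T gT) [T1 [e1 r1 n1]]]] := gS 0%N isT.
have [|/(_ T1 r1) [T' [e' r' n']]] := IH (g \o succn) _ gn.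
  by move=> m mn; exact: gS.
exists T'; split=> //; last by rewrite n'.
apply: reach_step; rewrite /pstep /= act_id (nonzeroE _ gT) g0.
apply: (@reach_trans _ _ (whilep (nonzero v) P) _ (Some None, T1)) e'.
by apply: (@reach_embed _ _ P (whilep (nonzero v) P) Some Some _ _ _ _ _ _ e1).
Qed.

(** * Calling a machine as a subroutine *)

Section Call.
Variable v : 'I_K.

(** The argument is written leftwards from wherever the head happens to be; one final step to the
    right puts the head at the left end of the block, which serves as the origin for [M]. *)
Let load : program :=
  seqp (whilep (nonzero v)
    (basic (fun a => upd (upd (still a) (R v) (a (R v), MoveL))
                         (W ord0) (mark, MoveL))))
    (one (W ord0) (fun x => (x, MoveR))).

Let loaded (n : nat) (off z : int) : S :=
  if off <= z < off + n%:Z then mark else None.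

Let exec_load s T : Rep s T -> exists off,
  exec load T (upd (upd T (R v) (regtape 0)) (W ord0) (loaded (s v) off, off)).
Proof.
case=> TR TW; set h := (T (W ord0)).2.
exists (h - (s v)%:Z + 1).
pose g m := upd (upd T (R v) (regtape (s v - m)))
  (W ord0) (loaded m (h - m%:Z + 1), h - m%:Z).
have T0 : T = g 0%N.
  apply/funext => j; rewrite /g /upd; case: eqP => [->|_].
    rewrite /h; have := TW ord0; case: (T (W ord0)) => t h' /= t0.
    congr pair; last by rewrite subr0.
    by apply/funext => z; rewrite t0 /loaded; case: ifP => //; lia.
  by case: eqP => // ->; rewrite subn0 TR.
rewrite {1}T0; apply: (@exec_seq _ _ _ _ _ (g (s v))).
  apply: exec_while => [m mv|].
    split.
      rewrite /nonzero /g upd_diff // upd_same scan_regtape.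
      by rewrite subn_eq0 leqNgt mv.
    have := exec_basic (fun a => upd (upd (still a) (R v) (a (R v), MoveL))
                         (W ord0) (mark, MoveL)) (g m).
    rewrite !act_upd act_id act1_move.
    have -> : g m (R v) = regtape (s v - m) by rewrite /g upd_diff // upd_same.
    have -> : g m (W ord0) = (loaded m (h - m%:Z + 1), h - m%:Z).
      by rewrite /g upd_same.
    congr exec; apply/funext => j; rewrite /g /upd.
    case: eqP => [_|_].
      congr pair; last by rewrite /=; lia.
      apply/funext => z; rewrite /loaded /=.
      by case: eqP => [->|hz]; do ?case: ifP => //; lia.
    case: eqP => // _; rewrite /regtape; congr pair; rewrite /=; lia.
  by rewrite /nonzero /g upd_diff // upd_same subnn negbK scan_regtape.
have := exec_one (W ord0) (fun x => (x, MoveR)) (g (s v)).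
rewrite act1_move /g upd_same upd_upd subnn /=.
by [].
Qed.

Let decode (x : S) : tm_symbol M := odflt (tm_blank M) x.

(** Every step of [M] writes a [Some] into the scanned cell of each tape, even when the symbol is
    blank, so all cells it leaves behind are recorded. *)
Let simulate : program := @Prog _ _ (tm_state M) (tm_start M) (fun q a =>
  if tm_halt q then (None, still a) else
  let qa := tm_trans q [ffun i => decode (a (W i))] in
  (Some qa.1, fun j => if j is Some (inr i)
    then (Some (qa.2 i).1, (qa.2 i).2) else still a j)).

(** Written cells are those different from [None]; they form an interval which
    the head never leaves by more than one cell. *)
Definition visited (t : tape S) : Prop := exists l u,
  (forall z, (t.1 z != None) = (l <= z < u)) /\ l - 1 <= t.2 <= u.

Let visited_act1 t x d : visited t -> visited (act1 (Some x, d) t).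
Proof.
case: t => t h [l [u [tlu /= hlu]]].
exists (if l <= h then l else h), (if h < u then u else h + 1); split=> [z|] /=.
  case: (z =P h) => [->|zh].
    by rewrite (_ : (Some x != None) = true) //; do ?case: ifP => //; lia.
  by rewrite tlu; do ?case: ifP => //; lia.
by case: d => /=; do ?case: ifP => //; lia.
Qed.

Let exec_simulate (T : J -> tape S) (n : nat) :
  (forall i, visited (T (W i))) ->
  (forall i z, decode ((T (W i)).1 (z + (T (W i)).2)) =
     if i == ord0 then unary_tape M n z else tm_blank M) ->
  exists2 T', exec simulate T T' &
    [/\ T' None = T None, (forall u, T' (R u) = T (R u)),
        (forall i, visited (T' (W i)))
      & forall z, decode ((T' (W ord0)).1 (z + (T (W ord0)).2)) =
          unary_tape M (f n) z].
Proof.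
move=> Tv Tn; have [t [ht out]] := M_f n.
(* The tapes agree after decoding, each shifted by the initial position of its head. *)
pose sim (c : configuration M) (T' : J -> tape S) :=
  [/\ T' None = T None, (forall u, T' (R u) = T (R u)),
      (forall i, visited (T' (W i)))
    & forall i, (T' (W i)).2 = cf_head c i + (T (W i)).2 /\
       forall z, decode ((T' (W i)).1 (z + (T (W i)).2)) = cf_tape c i z].
(* The time [t] need not be the first halting time: the program leaves at the first halt, and
   further steps of [M] change nothing. *)
have halted (c : configuration M) :
    tm_halt (cf_state c) -> forall m, iter m (@tm_step M) c = c.
  by move=> hc m; elim: m => //= m ->; rewrite /tm_step hc.
suff sub c T' m : sim c T' -> tm_halt (cf_state (iter m (@tm_step M) c)) ->
    exists2 T'', @reach _ _ simulate (Some (cf_state c), T') (None, T'') &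
      sim (iter m (@tm_step M) c) T''.
  have [|T' e [? ? ? simT']] := sub (tm_init M n) T t _ ht.
    split=> // i; split=> [|z]; first by rewrite add0r.
    by rewrite Tn /=; case: (i == ord0).
  exists T' => //; split=> // z.
  by have [_ ->] := simT' ord0; rewrite out.
elim: m c T' => [|m IH] c T' simT'.
  move=> /= hc; exists T' => //; apply: reach_step.
  by rewrite /pstep /= hc act_id; exact: reach_refl.
have [hc _|hc] := boolP (tm_halt (cf_state c)).
  exists T'; last by rewrite halted.
  by apply: reach_step; rewrite /pstep /= hc act_id; exact: reach_refl.
rewrite iterSr => hm.
have [TN TR TV TW] := simT'.
have rd : [ffun i => decode (scan (T' (W i)))] =
    [ffun i => cf_tape c i (cf_head c i)].
  by apply/ffunP => i; rewrite !ffunE /scan; have [-> ->] := TW i.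
pose qa := tm_trans (cf_state c) [ffun i => cf_tape c i (cf_head c i)].
pose T1 := act (fun j => if j is Some (inr i)
    then (Some (qa.2 i).1, (qa.2 i).2) else still (fun j => scan (T' j)) j) T'.
have stepE : tm_step c = Configuration qa.1
    (fun i z => if z == cf_head c i then (qa.2 i).1 else cf_tape c i z)
    (fun i => move_head (qa.2 i).2 (cf_head c i)).
  by rewrite /tm_step (negbTE hc).
have [|T'' e simT''] := IH (tm_step c) T1 _ hm.
  split=> [|u|i|i].
  - by rewrite /T1 /act /= act1_id.
  - by rewrite /T1 /act /= act1_id.
  - exact: visited_act1.
  - have [hd tp] := TW i; rewrite stepE /T1 /act /= -/(W i) hd; split=> [|z].
      by case: (qa.2 i).2 => /=; lia.
    by rewrite (inj_eq (addIr _)); case: eqP.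
exists T'' => //; apply: reach_step.
rewrite /pstep /= (negbTE hc) /= rd -/qa.
by move: e; rewrite stepE.
Qed.


(** The scanned cell is filled first, so that the head stands inside the interval of written cells;
    the head then runs to the left end and erases rightwards. With [b], each mark met on the way
    increments [v]. *)
Let sweep (b : bool) (i : 'I_k) : program :=
  seqp (one (W i) (fun x => (Some (decode x), MoveN)))
  (seqp (whilep (fun a => a (W i) != None) (one (W i) (fun x => (x, MoveL))))
  (seqp (one (W i) (fun x => (x, MoveR)))
  (whilep (fun a => a (W i) != None)
    (basic (fun a => upd (upd (still a)
      (R v) (a (R v), if b && (a (W i) == mark) then MoveR else MoveN))
      (W i) (None, MoveR)))))).

Let marks (b : bool) (t : int -> S) (l : int) (n : nat) : nat :=
  (\sum_(0 <= m < n) (b && (t (l + m%:Z)%R == mark)))%N.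

Let exec_wipe b i (T : J -> tape S) (l : int) (n m : nat) :
  (forall z, ((T (W i)).1 z != None) = (l <= z < l + n%:Z)) ->
  (T (W i)).2 = l -> T (R v) = regtape m ->
  exec (whilep (fun a => a (W i) != None)
    (basic (fun a => upd (upd (still a)
      (R v) (a (R v), if b && (a (W i) == mark) then MoveR else MoveN))
      (W i) (None, MoveR)))) T
   (upd (upd T (R v) (regtape (m + marks b (T (W i)).1 l n)))
      (W i) (fun=> None, l + n%:Z)).
Proof.
move=> Tl hl TR.
pose g p := upd (upd T (R v) (regtape (m + marks b (T (W i)).1 l p)))
  (W i) (fun z => if l <= z < l + p%:Z then None else (T (W i)).1 z,
         l + p%:Z).
have T0 : T = g 0%N.
  apply/funext => j; rewrite /g /upd; case: eqP => [->|_].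
    case: (T (W i)) hl => t h /= ->; congr pair; last by rewrite addr0.
    by apply/funext => z; case: ifP => //; lia.
  by case: eqP => // ->; rewrite /marks big_geq // addn0 TR.
have -> : upd (upd T (R v) (regtape (m + marks b (T (W i)).1 l n)))
      (W i) (fun=> None, l + n%:Z) = g n.
  rewrite /g; congr (upd _ _ (_, _)); apply/funext => z.
  by rewrite -Tl; case: eqP.
rewrite {1}T0; apply: exec_while => [p pn|].
  have pE : scan (g p (W i)) = (T (W i)).1 (l + p%:Z).
    by rewrite /g upd_same /scan /=; case: ifP => //; lia.
  split; first by rewrite pE Tl; lia.
  have := exec_basic (fun a => upd (upd (still a)
      (R v) (a (R v), if b && (a (W i) == mark) then MoveR else MoveN))
      (W i) (None, MoveR)) (g p).
  rewrite !act_upd act_id act1_move pE.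
  have -> : g p (R v) = regtape (m + marks b (T (W i)).1 l p).
    by rewrite /g upd_diff // upd_same.
  congr exec; apply/funext => j.
  have [->|jW] := eqVneq j (W i).
    rewrite /g !upd_same /act1; congr pair; last by rewrite /=; lia.
    apply/funext => z /=; case: (z =P _) => [->|zl].
      by case: ifP => //; lia.
    by do ?case: ifP => //; lia.
  have [->|jR] := eqVneq j (R v); last by rewrite /g !upd_diff.
  rewrite /g !(@upd_diff _ _ _ (W i) (R v)) // !upd_same.
  rewrite /marks big_nat_recr //= addnA /regtape; congr pair.
  by case: (b && _) => /=; rewrite ?addn0 // PoszD.
rewrite negbK; apply/eqP; rewrite /g upd_same /scan /=.
case: ifP => // H; apply/eqP; rewrite -[_ == _]negbK Tl; lia.
Qed.

Let exec_sweep b i (T : J -> tape S) m :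
  visited (T (W i)) -> T (R v) = regtape m ->
  exists h n, exec (sweep b i) T
      (upd (upd T (R v) (regtape (m + n))) (W i) (fun=> None, h)) /\
    if b then forall off p, (forall z, ((T (W i)).1 z == mark) =
      (off <= z < off + p%:Z)) -> n = p
    else n = 0%N.
Proof.
case et: (T (W i)) => [t h] [l0 [u0 [/= t0lu h0lu]]] TR.
pose t1 z := if z == h then Some (decode (t h)) else t z.
have [l [n [t1l lh]]] : exists (l : int) (n : nat),
    (forall z, (t1 z != None) = (l <= z < l + n%:Z)) /\ l <= h < l + n%:Z.
  (* The scanned cell lies in the old interval or next to it, so adding it leaves an interval. *)
  pose l := if l0 <= h then l0 else h; pose u := if h < u0 then u0 else h + 1.
  exists l, `|u - l|%N; have -> : l + `|u - l|%N = u :> int.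
    by rewrite /u /l; do ?case: ifP => //; lia.
  split=> [z|]; last by rewrite /u /l; do ?case: ifP => //; lia.
  rewrite /t1 /u /l; case: (z =P h) => [->|zh].
    by rewrite (_ : (Some _ != None) = true) //; do ?case: ifP => //; lia.
  by rewrite t0lu; do ?case: ifP => //; lia.
pose T1 x := upd T (W i) (t1, x).
exists (l + n%:Z), (marks b t1 l n); split.
  apply: (@exec_seq _ _ _ _ _ (T1 h)).
    have := exec_one (W i) (fun x => (Some (decode x), MoveN)) T.
    by rewrite et.
  apply: (@exec_seq _ _ _ _ _ (T1 (l - 1))).
    pose g m := T1 (h - m%:Z).
    have -> : T1 h = g 0%N by rewrite /g subr0.
    have -> : T1 (l - 1) = g `|(h - l + 1)%R|%N.
      by rewrite /g; congr T1; lia.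
    apply: exec_while => [p ph|].
      split; first by rewrite /g /T1 upd_same /scan /= t1l; lia.
      have := exec_one (W i) (fun x => (x, MoveL)) (g p).
      rewrite act1_move /g /T1 upd_same upd_upd /= -addrA -opprD.
      by rewrite -(addn1 p) PoszD.
    by rewrite /g /T1 upd_same /scan /= t1l; lia.
  apply: (@exec_seq _ _ _ _ _ (T1 l)).
    have := exec_one (W i) (fun x => (x, MoveR)) (T1 (l - 1)).
    by rewrite act1_move /T1 upd_same upd_upd /= subrK.
  have := @exec_wipe b i (T1 l) l n m.
  rewrite /T1 upd_same [X in _ -> _ -> X = _ -> _]upd_diff //.
  move=> /(_ t1l erefl TR); rewrite [upd (upd T _ _) _ _]updC //.
  by rewrite upd_upd.
rewrite /marks; case: b => /=; last by rewrite big1.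
move=> off p tm.
(* Filling the scanned cell can only turn an empty cell into a blank, which is not a mark. *)
have t1m z : (t1 z == mark) = (off <= z < off + p%:Z).
  rewrite -tm /t1 /=; case: (z =P h) => // ->.
  case: (t h) => [a|] //=; rewrite /decode /=.
  by apply: contraTF (tm_markP M) => /eqP[->]; rewrite eqxx.
under eq_bigr => j _ do rewrite t1m.
(* An empty output block may lie outside the written interval; a non-empty one lies inside because
   its two end cells carry marks. *)
case: p {tm} t1m => [|p] t1m.
  by rewrite big1 // => j _; rewrite (_ : (_ <= _ < _) = false) //; lia.
have bnd z : off <= z < off + p.+1%:Z -> l <= z < l + n%:Z.
  by rewrite -t1m -t1l => /eqP ->.
apply: count_interval.
  by have /bnd /andP[] : off <= off < off + p.+1%:Z by lia.
by have /bnd : off <= off + p%:Z < off + p.+1%:Z; lia.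
Qed.

Let exec_sweeps r (T : J -> tape S) :
  (forall i, visited (T (W i))) -> (exists n, T (R v) = regtape n) ->
  exists T', [/\ exec (foldr (fun i => seqp (sweep false i)) skip r) T T',
    T' None = T None, forall u, T' (R u) = T (R u) &
    forall i, i \in r \/ (forall z, (T (W i)).1 z = None) ->
      forall z, (T' (W i)).1 z = None].
Proof.
move=> + [n]; elim: r T => [|i r IH] T Tv TR /=.
  exists T; split=> // [|i [//|//]].
  by have := exec_basic still T; rewrite act_id.
have [h [p [e1 p0]]] := exec_sweep false (Tv i) TR.
rewrite p0 addn0 -TR upd_self in e1.
have [||T' [e T'N T'R T'W]] := IH (upd T (W i) (fun=> None, h)).
- move=> i'; rewrite /upd; case: eqP => // _.
  by exists h, h; split=> /= [z|]; lia.
- by rewrite upd_diff.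
exists T'; split=> // [|i']; first exact: exec_seq e1 e.
rewrite in_cons => i'r; apply: T'W.
rewrite /upd; case: eqP => [_|ii']; first by right.
case: i'r => [/orP[/eqP i'i|]|]; [|by left|by right].
by case: ii'; rewrite i'i.
Qed.

(** Loading leaves 0 in [v], so the first sweep, the only one that counts, stores the output there;
    the later sweeps only erase. *)
Definition call : program :=
  seqp load (seqp simulate (seqp (sweep true ord0)
    (foldr (fun i => seqp (sweep false i)) skip (enum 'I_k)))).

Lemma runs_call s : runs call s (upd s v (f (s v))).
Proof.
split=> T sT; have [TR TW] := sT.
have [off e1] := exec_load sT.
set T1 := upd _ (W ord0) _ in e1.
have T1R u : T1 (R u) = regtape (upd s v 0%N u).
  have [r _] := Rep_upd v 0 sT.
  by rewrite -r /T1 upd_diff.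
have T1W i : T1 (W i) = if i == ord0 then (loaded (s v) off, off) else T (W i).
  have [->|i0] := eqVneq i ord0; first by rewrite /T1 upd_same.
  rewrite /T1 !upd_diff //; apply: contra i0 => /eqP[->]; exact: eqxx.
have [i|i z|T2 e2 [T2N T2R T2v out]] := @exec_simulate T1 (s v).
- rewrite T1W; case: eqP => _.
    exists off, (off + (s v)%:Z); split=> /= [z|]; last by lia.
    by rewrite /loaded; case: ifP.
  exists (T (W i)).2, (T (W i)).2; split=> [z|]; last by lia.
  by rewrite TW eqxx; lia.
- rewrite T1W; case: eqP => _ /=; last by rewrite TW.
  rewrite /loaded /unary_tape (_ : (off <= z + off < _) = (0 <= z < (s v)%:Z)).
    by case: ifP.
  by lia.
have T2v0 : T2 (R v) = regtape 0 by rewrite T2R T1R upd_same.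
have [h [n [e3 nE]]] := exec_sweep true (T2v ord0) T2v0.
have {}nE : n = f (s v).
  apply: (nE off) => z; have := out (z - off).
  rewrite T1W eqxx /= subrK /unary_tape.
  rewrite (_ : (0 <= z - off < _) = (off <= z < off + (f (s v))%:Z)); last lia.
  case: ((T2 (W ord0)).1 z) => [a|] /=; case: ifP => _ //.
  - by move=> ->; exact: eqxx.
  - move=> ->; apply/eqP => -[] /eqP.
    by rewrite eq_sym (negbTE (tm_markP M)).
  - by move=> /eqP; rewrite eq_sym (negbTE (tm_markP M)).
rewrite add0n nE in e3; set T3 := upd _ (W ord0) _ in e3.
have [||T4 [e4 T4N T4R T4W]] := @exec_sweeps (enum 'I_k) T3.
- move=> i; rewrite /T3 {1}/upd; case: eqP => _; last by rewrite upd_diff.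
  by exists h, h; split=> /= [z|]; lia.
- by exists (f (s v)); rewrite /T3 upd_diff // upd_same.
exists T4; split.
- exact: exec_seq e1 (exec_seq e2 (exec_seq e3 e4)).
- split=> [u|i z]; last by apply: T4W; left; rewrite mem_enum.
  rewrite T4R /T3 upd_diff //; have [->|uv] := eqVneq u v.
    by rewrite !upd_same.
  have RuRv : R u != R v by apply: contra uv => /eqP[->]; exact: eqxx.
  by rewrite upd_diff // T2R T1R !upd_diff.
- by rewrite T4N /T3 !upd_diff // T2N /T1 !upd_diff.
Qed.

End Call.

(** The input is counted in [x] and, to bring the head of the input tape back,
    also in [y]. *)
Definition with_io x y o (P : program) : program :=
  seqp (basic (fun a j =>
    if j is Some (inl _) then (mark, MoveN) else still a j))
  (seqp (whilep (fun a => a None == mark)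
    (basic (fun a => upd (upd (upd (still a) (R x) (a (R x), MoveR))
       (R y) (a (R y), MoveR)) None (None, MoveR))))
  (seqp (whilep (nonzero y)
    (basic (fun a => upd (upd (still a) (R y) (a (R y), MoveL))
       None (a None, MoveL))))
  (seqp P
  (whilep (nonzero o)
    (basic (fun a => upd (upd (still a) (R o) (a (R o), MoveL))
       None (mark, MoveR))))))).

Lemma recursive_runs x y o P g : x != y ->
  (forall n, exists2 s, runs P (upd (fun=> 0%N) x n) s & s o = g n) ->
  recursive g.
Proof.
move=> xy Pg.
have mb : mark != None by [].
apply: (@recursive_exec _ _ None mark mb (with_io x y o P)) => n.
have [s [sP] so] := Pg n.
pose cfg a b t (j : J) : tape S := match j with
  | None => t
  | Some (inl v) => regtape (if v == y then b else if v == x then a else 0%N)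
  | Some (inr _) => (fun=> None, 0)
  end.
pose io p (m : nat) : tape S :=
  (fun z : int => if p <= z < n%:Z then mark else None, m%:Z).
(* [A m], [B m] and, below, [C m] are the tapes after [m] rounds of the loops that read the input,
   rewind its head and write the output. *)
pose A m := cfg m m (io m%:Z m).
pose B m := cfg n (n - m)%N (io n%:Z (n - m)%N).
have RE u v : (R u == R v) = (u == v) by [].
have regS m : ((regtape m).1, move_head MoveR (regtape m).2) = regtape m.+1.
  by rewrite /regtape /= -(addn1 m) PoszD.
have regP m p : (m < p)%N ->
    ((regtape (p - m)).1, move_head MoveL (regtape (p - m)).2) =
    regtape (p - m.+1).
  by move=> mp; rewrite /regtape /=; congr pair; lia.
have RxRy : R x != R y by apply: contra xy => /eqP[->]; exact: eqxx.
have RyRx : R y != R x by rewrite eq_sym.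
have Ax m : A m (R x) = regtape m by rewrite /A /= (negbTE xy) eqxx.
have Ay m : A m (R y) = regtape m by rewrite /A /= eqxx.
have By m : B m (R y) = regtape (n - m) by rewrite /B /= eqxx.
have [|T [eT [TR TW] TN]] := sP (cfg n 0%N (fun=> None, 0)).
  split=> // v; rewrite /= /upd; case: eqP => [->|] //.
  by rewrite eq_sym (negbTE xy).
pose C m := upd (upd T (R o) (regtape (s o - m)))
  None (fun z : int => if 0 <= z < m%:Z then mark else None, m%:Z).
have Co m : C m (R o) = regtape (s o - m) by rewrite /C upd_diff // upd_same.
exists (C (g n)); last first.
  by rewrite /C upd_same.
apply: (@exec_seq _ _ _ _ _ (A 0%N)).
  (* The first instruction marks the origin of every register, which makes all of them 0. *)
  rewrite (_ : A 0%N = act (fun j => if j is Some (inl _) then (mark, MoveN)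
     else still (fun j => scan (start_tapes None mark n j)) j)
     (start_tapes None mark n)).
    exact: exec_basic.
  apply/funext => -[[u|i]|]; rewrite /act /A /cfg /start_tapes.
  - by rewrite /act1 /regtape /=; do ?case: ifP.
  - by rewrite act1_id.
  - by rewrite act1_id.
apply: (@exec_seq _ _ _ _ _ (A n)).
  apply: exec_while => [m mn|].
    split; first by rewrite /scan /= lexx ltz_nat mn.
    have := exec_basic (fun a => upd (upd (upd (still a) (R x) (a (R x), MoveR))
       (R y) (a (R y), MoveR)) None (None, MoveR)) (A m).
    rewrite !act_upd act_id !act1_move Ax Ay !regS.
    congr exec; apply/funext => -[[u|i]|] //.
      rewrite upd_diff // /upd /= -!/(R _) !RE; case: eqP => // _; by case: eqP.
    rewrite upd_same /A /cfg /io /act1 /=; congr pair; last by lia.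
    by apply/funext => z; do ?case: ifP => //; lia.
  by rewrite /scan /=; case: ifP => //; lia.
apply: (@exec_seq _ _ _ _ _ (B n)).
  have -> : A n = B 0%N by rewrite /A /B subn0.
  apply: exec_while => [m mn|].
    split; first by rewrite /nonzero By scan_regtape subn_eq0 leqNgt mn.
    have := exec_basic (fun a => upd (upd (still a) (R y) (a (R y), MoveL))
       None (a None, MoveL)) (B m).
    rewrite !act_upd act_id !act1_move By regP //.
    congr exec; apply/funext => -[[u|i]|] //.
      by rewrite upd_diff // /upd /= -!/(R _) !RE; case: eqP.
    by rewrite upd_same /B /cfg /io /=; congr pair; lia.
  by rewrite /nonzero negbK By subnn scan_regtape.
apply: (@exec_seq _ _ _ _ _ T).
  move: eT; congr exec; apply/funext => -[[u|i]|] //.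
    by rewrite /B /= subnn.
  rewrite /B /= subnn /io; congr pair; apply/funext => z; case: ifP => //; lia.
rewrite -so.
have -> : T = C 0%N.
  apply/funext => -[[u|i]|]; rewrite /C subn0.
  - by rewrite upd_diff // /upd -!/(R _) RE; case: eqP => [->|//]; exact: TR.
  - by rewrite !upd_diff.
  - rewrite upd_same TN /=; congr pair.
    by apply/funext => z; case: ifP => //; lia.
apply: exec_while => [m mo|].
  split; first by rewrite /nonzero Co scan_regtape subn_eq0 leqNgt mo.
  have := exec_basic (fun a => upd (upd (still a) (R o) (a (R o), MoveL))
     None (mark, MoveR)) (C m).
  rewrite !act_upd act_id !act1_move Co regP //.
  congr exec; apply/funext => -[[u|i]|] //.
    by rewrite /C !(@upd_diff _ _ _ None) // /upd -!/(R _) !RE; case: eqP.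
  rewrite upd_same /act1 /C !upd_same /=; congr pair; last by lia.
  by apply/funext => z; do ?case: ifP => //; lia.
by rewrite /nonzero negbK Co subnn scan_regtape.
Qed.

End RegisterPrograms.

(** * Recursiveness of the strategies *)

(** Register states are compared pointwise: index tests settled by a hypothesis are rewritten, and
    only the others lead to a case split. *)
Ltac upd_cases :=
  apply: funext; intro; rewrite /upd;
  repeat first
  [ match goal with
    | |- context [@eq_op _ ?i ?i] => rewrite (eqxx i)
    | H : is_true (negb (@eq_op _ ?i ?j)) |- context [@eq_op _ ?i ?j] =>
        rewrite (negbTE H)
    | H : is_true (negb (@eq_op _ ?i ?j)) |- context [@eq_op _ ?j ?i] =>
        rewrite (eq_sym j i) (negbTE H)
    end
  | match goal with |- context [@eq_op _ ?x ?i] =>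
      let H := fresh in
      case: (eqVneq x i) => H; [rewrite ?H; clear H | idtac]
    end ]; rewrite /=.

(** * Arithmetic on registers *)

Section Macros.
Local Open Scope nat_scope.
Variables (K : nat) (M : turing_machine).
Implicit Types (i j t h p : 'I_K) (s : 'I_K -> nat).
Local Notation inc := (inc M).
Local Notation dec := (dec M).

Lemma runs_to (P : prog _ _) s s1 s2 :
  runs (M := M) P s s1 -> s1 = s2 -> runs P s s2.
Proof. by move=> ? <-. Qed.

Definition add_const c i := iter c (seqp (inc i)) (skip K M).

Lemma runs_add_const c i s : runs (add_const c i) s (upd s i (s i + c)).
Proof.
elim: c s => [|c IH] s /=.
  by rewrite addn0 upd_self; exact: runs_skip.
apply: runs_to (runs_seq (runs_inc _ _ _) (IH _)) _.
by upd_cases; try lia.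
Qed.

Definition mv i j := whilep (nonzero (M := M) i) (seqp (dec i) (inc j)).

Lemma runs_mv i j s : i != j -> runs (mv i j) s (upd (upd s j (s j + s i)) i 0).
Proof.
move=> ij; pose g m := upd (upd s j (s j + m)) i (s i - m).
have -> : s = g 0 by rewrite /g; upd_cases; lia.
have -> : upd (upd (g 0) j (g 0 j + g 0 i)) i 0 = g (s i).
  by rewrite /g; upd_cases; lia.
apply: runs_while => [m mi|]; last by rewrite /g upd_same subnn.
split; first by rewrite /g upd_same; lia.
apply: runs_to (runs_seq (runs_dec _ _ _) (runs_inc _ _ _)) _.
by rewrite /g; upd_cases; lia.
Qed.

Definition copy i j t := seqp
  (whilep (nonzero (M := M) i) (seqp (dec i) (seqp (inc j) (inc t)))) (mv t i).

Lemma runs_copy i j t s : i != j -> i != t -> j != t -> s t = 0 ->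
  runs (copy i j t) s (upd s j (s j + s i)).
Proof.
move=> ij it jt st.
pose g m := upd (upd (upd s i (s i - m)) j (s j + m)) t m.
have {1}-> : s = g 0 by rewrite /g; upd_cases; lia.
apply: (@runs_seq _ _ _ _ _ (g (s i))).
  apply: runs_while => [m mi|]; last first.
    by rewrite /g /upd (negbTE ij) (negbTE it) eqxx subnn.
  split; first by rewrite /g /upd (negbTE ij) (negbTE it) eqxx; lia.
  apply: runs_to (runs_seq (runs_dec _ _ _)
    (runs_seq (runs_inc _ _ _) (runs_inc _ _ _))) _.
  by rewrite /g; upd_cases; lia.
apply: runs_to (runs_mv _ _) _; first by rewrite eq_sym.
by rewrite /g; upd_cases; lia.
Qed.

Definition mul_const c i t := seqp
  (whilep (nonzero (M := M) i) (seqp (dec i) (add_const c t))) (mv t i).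

Lemma runs_mul_const c i t s : i != t -> s t = 0 ->
  runs (mul_const c i t) s (upd s i (c * s i)).
Proof.
move=> it st.
pose g m := upd (upd s i (s i - m)) t (c * m).
have {1}-> : s = g 0 by rewrite /g; upd_cases; lia.
apply: (@runs_seq _ _ _ _ _ (g (s i))).
  apply: runs_while => [m mi|]; last by rewrite /g /upd (negbTE it) eqxx subnn.
  split; first by rewrite /g /upd (negbTE it) eqxx; lia.
  apply: runs_to (runs_seq (runs_dec _ _ _) (runs_add_const _ _ _)) _.
  by rewrite /g; upd_cases; lia.
apply: runs_to (runs_mv _ _) _; first by rewrite eq_sym.
by rewrite /g; upd_cases; lia.
Qed.

(** Undoes one step of [code_situation]: from [2 * c + x + 1] it leaves the code [c] of the shorter
    situation in [i] and the removed bit [x], as a parity, in [p]. *)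
Definition half_pred i h p := seqp (dec i) (seqp
  (whilep (nonzero (M := M) i) (seqp (dec i)
     (ifp (nonzero (M := M) p) (seqp (dec p) (inc h)) (inc p)))) (mv h i)).

Lemma runs_half_pred i h p s :
  i != h -> i != p -> h != p -> s h = 0 -> s p = 0 ->
  runs (half_pred i h p) s (upd (upd s i (s i).-1./2) p (odd (s i).-1)).
Proof.
move=> ih ip hp sh sp.
apply: runs_seq (runs_dec _ _ _) _.
pose g m := upd (upd (upd s i ((s i).-1 - m)) h m./2) p (odd m).
have -> : upd s i (s i).-1 = g 0 by rewrite /g; upd_cases; lia.
apply: (@runs_seq _ _ _ _ _ (g (s i).-1)).
  apply: runs_while => [m mi|]; last first.
    by rewrite /g /upd (negbTE ih) (negbTE ip) eqxx subnn.
  split; first by rewrite /g /upd (negbTE ih) (negbTE ip) eqxx; lia.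
  apply: runs_seq (runs_dec _ _ _) _.
  apply: runs_if; rewrite upd_diff 1?eq_sym // /g upd_same.
  case: ifP => om.
    apply: runs_to (runs_seq (runs_dec _ _ _) (runs_inc _ _ _)) _.
    by upd_cases; try lia.
  apply: runs_to (runs_inc _ _ _) _.
  by upd_cases; try lia.
apply: runs_to (runs_mv _ _) _; first by rewrite eq_sym.
by rewrite /g; upd_cases; lia.
Qed.

End Macros.

(** * Decoding situations and pairs *)

Section Codes.
Local Open Scope nat_scope.

Lemma code_situation_rcons s x :
  code_situation (rcons s x) = (code_situation s).*2 + x.+1.
Proof. by rewrite /code_situation -cats1 foldl_cat. Qed.

Lemma code_situation_take s n : n < size s ->
  code_situation (take n.+1 s) =
  (code_situation (take n s)).*2 + (nth false s n).+1.
Proof. by move=> ns; rewrite (take_nth false) // code_situation_rcons. Qed.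

(** Walks along Cantor's diagonals one pair at a time, so that a single loop of increments,
    decrements and moves can follow it. *)
Fixpoint uncode_pair (x : nat) : nat * nat :=
  if x is x'.+1 then
    let: (a, b) := uncode_pair x' in
    if a is a'.+1 then (a', b.+1) else (b.+1, 0)
  else (0, 0).

(** Induction along the walk shows that [code_pair] undoes [uncode_pair]; bijectivity of [code_pair]
    gives the other order. *)
Lemma code_pairK a b : uncode_pair (code_pair a b) = (a, b).
Proof.
have K x : code_pair (uncode_pair x).1 (uncode_pair x).2 = x.
  elim: x => [|x IH] //=; case: (uncode_pair x) IH => -[|a'] b' /= <-.
    by rewrite /code_pair !addn0 add0n [in LHS]binS bin1 addnS.
  by rewrite /code_pair addSnnS addnS.
have [g gK _] := code_pair_bij.
by rewrite -[LHS]gK K (gK (a, b)).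
Qed.

End Codes.

(** * Programs for the capital and the selection count *)

Section Programs.
Local Open Scope nat_scope.
Variables (sigma : selection) (M : turing_machine).
Hypothesis M_sigma : tm_computes M (fun k => sigma k : nat).

(** The input; the components of the pair it codes; the length of the situation;
    a copy of its code; a half and a parity; the product or sum; the argument of
    the selection function; a register used for copying. *)
Local Notation reg n := (@Ordinal 10 n isT).
Local Notation rx := (reg 0).
Local Notation ra := (reg 1).
Local Notation rb := (reg 2).
Local Notation rl := (reg 3).
Local Notation rc := (reg 4).
Local Notation rh := (reg 5).
Local Notation rp := (reg 6).
Local Notation rv := (reg 7).
Local Notation rn := (reg 8).
Local Notation rt := (reg 9).

Local Notation prog' :=
  (prog (option ('I_10 + 'I_(tm_aux M).+1)) (option (tm_symbol M))).
Local Notation while v := (whilep (nonzero (M := M) v)).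
Local Notation ifnz v := (ifp (nonzero (M := M) v)).
Local Notation inc := (inc M).
Local Notation dec := (dec M).
Local Notation mv := (mv M).
Local Notation copy := (copy M).

Definition st (l : seq nat) (v : 'I_10) : nat := nth 0 l v.

Lemma upd_st l (v : 'I_10) n : upd (st l) v n = st (set_nth 0 l v n).
Proof. by apply/funext => u; rewrite /upd /st nth_set_nth. Qed.

Definition unpair_input : prog' :=
  while rx (seqp (dec rx)
    (ifnz ra (seqp (dec ra) (inc rb)) (seqp (mv rb ra) (inc ra)))).

Lemma runs_unpair x : runs unpair_input (upd (fun=> 0) rx x)
  (st [:: 0; (uncode_pair x).1; (uncode_pair x).2; 0; 0; 0; 0; 0; 0; 0]).
Proof.
pose g m := st [:: x - m; (uncode_pair m).1; (uncode_pair m).2;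
  0; 0; 0; 0; 0; 0; 0].
apply: (@runs_to _ _ _ _ (g x)); last by rewrite /g subnn.
have -> : upd (fun=> 0) rx x = g 0.
  by rewrite /g subn0; apply/funext => -[[|[|[|[|[|[|[|[|[|[|]]]]]]]]]] i].
apply: (@runs_while _ _ _ _ g) => [m mx|]; last by rewrite /g /st /= subnn.
split; first by rewrite /g /st /= subn_eq0 -ltnNge.
apply: runs_seq (runs_dec _ _ _) _; apply: runs_if.
rewrite /g upd_st /= /st -/(st _) /=.
case: (uncode_pair m) => -[|a] b /=.
  apply: runs_to (runs_seq (runs_mv _ _ _) (runs_inc _ _ _)) _ => //.
  by rewrite !upd_st /st /=; congr (st [:: _, _ & _]); lia.
apply: runs_to (runs_seq (runs_dec _ _ _) (runs_inc _ _ _)) _ => //.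
by rewrite !upd_st /st /=; congr (st [:: _, _ & _]); lia.
Qed.

Definition situation_length : prog' := seqp (copy ra rc rt)
  (while rc (seqp (half_pred M rc rh rp) (seqp (dec rp) (inc rl)))).

Lemma runs_situation_length s b : runs situation_length
  (st [:: 0; code_situation s; b; 0; 0; 0; 0; 0; 0; 0])
  (st [:: 0; code_situation s; b; size s; 0; 0; 0; 0; 0; 0]).
Proof.
apply: runs_seq; first by apply: runs_copy.
(* Each round strips the last bit, so the code left is that of an initial segment. *)
pose g m := st [:: 0; code_situation s; b; m;
  code_situation (take (size s - m) s); 0; 0; 0; 0; 0].
apply: (@runs_to _ _ _ _ (g (size s))); last by rewrite /g subnn take0.
rewrite (_ : upd _ _ _ = g 0); last by rewrite upd_st /g subn0 take_size.
apply: (@runs_while _ _ _ _ g) => [m ms|]; last by rewrite /g /st /= subnn take0.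
rewrite /g.
have ns : size s - m.+1 < size s by lia.
have -> : size s - m = (size s - m.+1).+1 by lia.
rewrite code_situation_take //; move: (size s - m.+1) ns => n ns.
split; first by rewrite /st /= addnS.
apply: runs_to (runs_seq (runs_half_pred _ _ _ _ _ _)
  (runs_seq (runs_dec _ _ _) (runs_inc _ _ _))) _ => //.
rewrite !upd_st /st /= addnS /= addnC half_bit_double.
by congr st; rewrite oddD odd_double addbF oddb; case: (nth _ _ _).
Qed.

Section Weights.
Variables w0 w1 w2 w3 : nat.

Definition weight (s : situation) (k : nat) : nat :=
  if sigma k then if nth false s k then w1 else w2 else w3.

(** Bits come off the code from last to first, so the length computed beforehand tells which entry
    is current; [rl] is decreased before the call because entries are indexed from 0. *)
Definition weight_product : prog' := seqp (add_const M w0 rv)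
  (while ra (seqp (half_pred M ra rh rp) (seqp (dec rl)
    (seqp (copy rl rn rt) (seqp (call M rn)
    (seqp (ifnz rn (seqp (dec rn)
      (ifnz rp (mul_const M w1 rv rt) (mul_const M w2 rv rt)))
      (mul_const M w3 rv rt)) (dec rp))))))).

Lemma runs_weight_product s b : runs weight_product
  (st [:: 0; code_situation s; b; size s; 0; 0; 0; 0; 0; 0])
  (st [:: 0; 0; b; 0; 0; 0; 0; w0 * \prod_(0 <= k < size s) weight s k; 0; 0]).
Proof.
apply: runs_seq; first by apply: runs_add_const.
pose g m := st [:: 0; code_situation (take (size s - m) s); b; size s - m;
  0; 0; 0; w0 * \prod_(size s - m <= k < size s) weight s k; 0; 0].
apply: (@runs_to _ _ _ _ (g (size s))); last by rewrite /g subnn take0.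
rewrite (_ : upd _ _ _ = g 0); last first.
  by rewrite upd_st /g subn0 take_size big_geq // muln1.
apply: (@runs_while _ _ _ _ g) => [m ms|]; last by rewrite /g /st /= subnn take0.
rewrite /g.
have ns : size s - m.+1 < size s by lia.
have -> : size s - m = (size s - m.+1).+1 by lia.
rewrite code_situation_take // [in X in runs _ _ X]big_ltn //.
move: (size s - m.+1) ns => n ns.
split; first by rewrite /st /= addnS.
apply: runs_seq; first by apply: runs_half_pred.
apply: runs_seq; first by apply: runs_dec.
apply: runs_seq; first by apply: runs_copy; rewrite // !upd_st.
apply: runs_seq; first by apply: (runs_call M_sigma).
rewrite !upd_st /st /= addnS /= addnC half_bit_double.
rewrite oddD odd_double addbF oddb.
set v := w0 * _.
apply: (@runs_seq _ _ _ _ _ (st [:: 0; code_situation (take n s); b; n; 0; 0;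
  (nth false s n : nat); weight s n * v; 0; 0])); last first.
  apply: runs_to (runs_dec _ _ _) _; rewrite upd_st /=; congr st.
  by rewrite /v mulnCA; case: (nth _ _ _).
apply: runs_if; rewrite /weight /st /= -/(st _).
case: (sigma n) => /=; last first.
  by apply: runs_to (runs_mul_const _ _ _ _) _ => //; rewrite upd_st.
apply: runs_seq; first by apply: runs_dec.
apply: runs_if; rewrite upd_st /st /= -/(st _).
by case: (nth _ _ _) => /=;
   apply: runs_to (runs_mul_const _ _ _ _) _ => //; rewrite upd_st.
Qed.

End Weights.

Definition count_selected : prog' := while rx (seqp (dec rx)
  (seqp (copy rx rn rt) (seqp (call M rn) (mv rn rv)))).

Lemma runs_count_selected x : runs count_selected (upd (fun=> 0) rx x)
  (st [:: 0; 0; 0; 0; 0; 0; 0; \sum_(0 <= k < x) sigma k; 0; 0]).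
Proof.
pose g m := st [:: x - m; 0; 0; 0; 0; 0; 0;
  \sum_(x - m <= k < x) sigma k; 0; 0].
apply: (@runs_to _ _ _ _ (g x)); last by rewrite /g subnn.
have -> : upd (fun=> 0) rx x = g 0.
  rewrite /g subn0 big_geq //.
  by apply/funext => -[[|[|[|[|[|[|[|[|[|[|]]]]]]]]]] i].
apply: (@runs_while _ _ _ _ g) => [m mx|]; last by rewrite /g /st /= subnn.
rewrite /g; have nx : x - m.+1 < x by lia.
have -> : x - m = (x - m.+1).+1 by lia.
rewrite [in X in runs _ _ X]big_ltn //; move: (x - m.+1) nx => n nx.
split; first by [].
apply: runs_seq; first by apply: runs_dec.
apply: runs_seq; first by apply: runs_copy; rewrite // !upd_st.
apply: runs_seq; first by apply: (runs_call M_sigma).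
apply: runs_to (runs_mv _ _ _) _ => //.
by rewrite !upd_st /st /= addnC.
Qed.

End Programs.

Lemma recursive_count (sigma : selection) : recursive_selection sigma ->
  recursive (fun n => \sum_(0 <= k < n) sigma k)%N.
Proof.
case=> M M_sigma.
(* The input arrives in register 0, register 1 serves to rewind the input tape, and the result is in
   register 7. *)
apply: (@recursive_runs 10 M ord0 (lift ord0 ord0)
  (@Ordinal 10 7 isT) (count_selected M)) => // n.
by eexists; first exact: runs_count_selected.
Qed.

(** The numerator, the denominator and the sign exponent of the capital all have this form, for
    different weights. *)
Lemma recursive_family_product (sigma : selection) (w0 w1 w2 w3 : nat) :
  recursive_selection sigma ->
  recursive_family (fun s _ =>
    w0 * \prod_(0 <= k < size s) weight sigma w1 w2 w3 s k)%N.
Proof.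
case=> M M_sigma; have [decode _ decodeK] := code_situation_bij.
pose f s := (w0 * \prod_(0 <= k < size s) weight sigma w1 w2 w3 s k)%N.
exists (fun x => f (decode (uncode_pair x).1)) => [|s n]; last first.
  rewrite code_pairK /= -/(f s); congr f.
  by apply: (bij_inj code_situation_bij); rewrite decodeK.
apply: (@recursive_runs 10 M ord0 (lift ord0 ord0) (@Ordinal 10 7 isT)
  (seqp (unpair_input M) (seqp (situation_length M)
    (weight_product M w0 w1 w2 w3)))) => // x.
have := runs_unpair M x; rewrite -[(uncode_pair x).1]decodeK => up.
eexists; first exact: runs_seq up (runs_seq (runs_situation_length M _ _)
  (runs_weight_product M_sigma w0 w1 w2 w3 _ _)).
by rewrite decodeK.
Qed.

(** * Capital processes and limiting frequencies *)

Section LimitSuperior.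
Context {R : realType}.
Implicit Types (u : nat -> \bar R) (l : \bar R).

Lemma limn_esup_le_near u l : (\forall n \near \oo, (u n <= l)%E) ->
  (limn_esup u <= l)%E.
Proof.
move=> ul; rewrite /limn_esup limf_esupE.
apply: (@le_trans _ _ (ereal_sup (u @` [set n | (u n <= l)%E]))).
  by apply: ereal_inf_lbound; exists [set n | (u n <= l)%E].
by apply: ge_ereal_sup => _ [n /= ? <-].
Qed.

Lemma limn_esup_lt_near u l : (limn_esup u < l)%E ->
  \forall n \near \oo, (u n < l)%E.
Proof.
rewrite /limn_esup limf_esupE => /ereal_inf_lt[_ [V Vu <-] Vl].
apply: filterS Vu => n Vn; apply: le_lt_trans Vl.
by apply: ereal_sup_ubound; exists n.
Qed.

End LimitSuperior.

Section WeightedProcess.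
Variables (R : realType) (sigma : selection).
Hypothesis sigma_rec : recursive_selection sigma.
Variables a b d : nat.
Hypotheses (a0 : (0 < a)%N) (b0 : (0 < b)%N) (d0 : (0 < d)%N).

(** The capital of a gambler who, on the selected entries, multiplies it by
    [a / d] when a 1 is revealed and by [b / d] when a 0 is. *)
Definition capital (s : situation) : R :=
  (\prod_(0 <= k < size s) weight sigma a b d s k)%:R /
  (\prod_(0 <= k < size s) weight sigma d d d s k)%:R.

Lemma capital_nil : capital [::] = 1.
Proof. by rewrite /capital !big_geq // divr1. Qed.

Lemma prod_weight_rcons w1 w2 w3 s x :
  (\prod_(0 <= k < size (rcons s x)) weight sigma w1 w2 w3 (rcons s x) k =
   (\prod_(0 <= k < size s) weight sigma w1 w2 w3 s k) *
   (if sigma (size s) then if x then w1 else w2 else w3))%N.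
Proof.
rewrite size_rcons big_nat_recr //=; congr muln.
  apply: eq_big_nat => k /andP[_ ks].
  by rewrite /weight nth_rcons ks.
by rewrite /weight nth_rcons ltnn eqxx.
Qed.

Lemma prod_weight_gt0 w1 w2 w3 s : (0 < w1)%N -> (0 < w2)%N -> (0 < w3)%N ->
  (0 < \prod_(0 <= k < size s) weight sigma w1 w2 w3 s k)%N.
Proof.
move=> *; apply: prodn_gt0 => k; rewrite /weight.
by case: ifP => // _; case: ifP.
Qed.

Lemma capital_gt0 s : 0 < capital s.
Proof. by rewrite divr_gt0 // ltr0n prod_weight_gt0. Qed.

Lemma capital_rcons s x : capital (rcons s x) = capital s *
  (if sigma (size s) then (if x then a%:R else b%:R) / d%:R else 1).
Proof.
have dn0 : d%:R != 0 :> R by rewrite pnatr_eq0 -lt0n.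
have Dn0 : (\prod_(0 <= k < size s) weight sigma d d d s k)%:R != 0 :> R.
  by rewrite pnatr_eq0 -lt0n prod_weight_gt0.
rewrite /capital !prod_weight_rcons !natrM.
by case: (sigma _); case: x => /=; field; rewrite dn0 Dn0.
Qed.

Lemma capital_test : test_process capital.
Proof. by split; [move=> s; exact/ltW/capital_gt0|exact: capital_nil]. Qed.

(** The values are rational, so a constant approximation has error 0 and any recursive modulus will
    do; [num] is reused as one. *)
Lemma capital_computable : computable_process capital.
Proof.
pose num s (_ : nat) := (1 * \prod_(0 <= k < size s) weight sigma a b d s k)%N.
pose den s (_ : nat) := (1 * \prod_(0 <= k < size s) weight sigma d d d s k)%N.
(* The factor 0 gives the sign exponent 0 in the form covered by [recursive_family_product]. *)
pose sgn s (_ : nat) := (0 * \prod_(0 <= k < size s) weight sigma d d d s k)%N.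
exists (fun s n => (-1) ^+ sgn s n * ((num s n)%:R / (den s n)%:R)), num.
split; last 2 first.
- exact: recursive_family_product.
- move=> s N n _; rewrite /sgn mul0n expr0 mul1r fmorph_div /= !ratr_nat.
  by rewrite /num /den !mul1n subrr normr0 invr_ge0 exprn_ge0.
exists num, den, sgn; split=> //; try exact: recursive_family_product.
by move=> s n; rewrite /den mul1n prod_weight_gt0.
Qed.

(** On a selected entry the expected increment is [capital s / d] times [p * a + (1 - p) * b - d];
    on any other entry it is 0. *)
Lemma capital_supermartingale (I : interval_forecast R) :
  (forall p, lower I <= p <= upper I ->
     p * a%:R + (1 - p) * b%:R <= d%:R) ->
  supermartingale (stationary I) capital.
Proof.
move=> ab s; have /and3P[_ lu _] := interval_forecastP I.
apply: ge_sup.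
  exists (lower I * process_diff capital s true +
    (1 - lower I) * process_diff capital s false).
  by exists (lower I); rewrite //= in_itv /= lexx.
move=> _ [p /= pI <-]; rewrite /stationary in_itv /= in pI.
rewrite /process_diff !capital_rcons.
case: (sigma _) => /=; last by rewrite mulr1 subrr !mulr0 addr0.
have d1 : 0 < d%:R :> R by rewrite ltr0n.
rewrite (_ : _ + _ = capital s / d%:R *
    (p * a%:R + (1 - p) * b%:R - d%:R)); last first.
  by field; rewrite lt0r_neq0.
rewrite mulr_ge0_le0 ?subr_le0 ?ab //.
by rewrite divr_ge0 ?ltW ?capital_gt0.
Qed.

Definition bit_count (w : bitpath) (x : bool) (n : nat) : R :=
  \sum_(0 <= k < n) (sigma k)%:R * (w k == x)%:R.

Lemma bit_countC w x n :
  bit_count w (~~ x) n = selected_count R sigma n - bit_count w x n.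
Proof.
apply/eqP; rewrite eq_sym subr_eq /bit_count /selected_count -big_split /=.
apply/eqP/eq_bigr => k _; rewrite -mulrDr.
by case: (w k); case: x => /=; rewrite ?addr0 ?add0r mulr1.
Qed.

(** The logarithm of the capital is linear in the two counts, which ties its growth to
    frequencies. *)
Lemma capital_prefix w n : capital (prefix_of w n) =
  expR (bit_count w true n * ln (a%:R / d%:R) +
        bit_count w false n * ln (b%:R / d%:R)).
Proof.
elim: n => [|n IH].
  by rewrite /bit_count !big_geq // !mul0r addr0 expR0 capital_nil.
rewrite /prefix_of mkseqS capital_rcons -/(prefix_of w n) IH size_mkseq.
rewrite /bit_count !big_nat_recr //= -!/(bit_count _ _ _).
have [ad bd] : 0 < a%:R / d%:R :> R /\ 0 < b%:R / d%:R :> R.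
  by rewrite !divr_gt0 ?ltr0n.
case: (sigma n) => /=; last by rewrite !mul0r !addr0 mulr1.
have lnE x : 0 < x -> x = expR (ln x) :> R by move=> x0; rewrite lnK.
case: (w n) => /=.
  by rewrite [X in _ * X = _](lnE _ ad) -expRD; congr expR; ring.
by rewrite [X in _ * X = _](lnE _ bd) -expRD; congr expR; ring.
Qed.

End WeightedProcess.

(** * Frequencies along a path with moderate capital *)

Section Frequencies.
Context {R : realType}.
Variables (I : interval_forecast R) (sigma : selection) (w : bitpath).
Hypothesis sigma_rec : recursive_selection sigma.
Hypothesis count_infty : @selected_count R sigma n @[n --> \oo] --> +oo.
(** What both notions of randomness imply about multiplicative strategies. *)
Hypothesis moderate : forall F : real_process R,
  test_supermartingale (stationary I) F ->
  computable_process F -> (forall s, 0 < F s) ->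
  \forall n \near \oo, F (prefix_of w n) <= selected_count R sigma n + 1.

(** Squaring [1 + y <= expR y] at [y = c * x / 2] produces the term [c^2 * x^2 / 4], which is at
    least [x] once [x >= 4 / c^2]. *)
Lemma expR_gt_affine (c x : R) :
  0 < c -> 4 / c ^+ 2 <= x -> x + 1 < expR (c * x).
Proof.
move=> c0 cx; have c20 : 0 < c ^+ 2 by rewrite exprn_gt0.
have x0 : 0 < x by apply: lt_le_trans cx; rewrite divr_gt0.
rewrite ler_pdivrMr // in cx.
have cx0 : 0 < c * x by rewrite mulr_gt0.
apply: (@lt_le_trans _ _ ((1 + c * x / 2) ^+ 2)).
  have : 4 * x <= x * c ^+ 2 * x by rewrite ler_pM2r.
  nra.
set y := c * x / 2; have -> : c * x = y + y by rewrite /y; field.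
have y1 : 1 + y <= expR y by exact: expR_ge1Dx.
have y0 : 0 <= 1 + y by rewrite /y; lra.
by rewrite expRD expr2 ler_pM.
Qed.

(** At [r = v] this is the relative entropy of [v] with respect to [u]. The bound
    [1 - 1 / x <= ln x] shows that it is nonnegative there; passing from [v] to [r] adds
    [(r - v) * (A - B) > 0], with [A] and [B] the two logarithms. *)
Lemma kelly_rate_gt0 (u v r : R) : 0 < u -> u < v -> v < r -> r < 1 ->
  0 < r * ln (v / u) + (1 - r) * ln ((1 - v) / (1 - u)).
Proof.
move=> u0 uv vr r1.
have lnge (x : R) : 0 < x -> 1 - x^-1 <= ln x.
  move=> x0; have := @le_ln1Dx R (x^-1 - 1).
  rewrite addrCA subrr addr0 lnV ?posrE //.
  by have := x0; rewrite -invr_gt0; lra.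
have lnA : (v - u) / v <= ln (v / u).
  have := lnge (v / u); rewrite divr_gt0 //; last by lra.
  by move=> /(_ isT); congr (_ <= _); field; lra.
have lnB : (u - v) / (1 - v) <= ln ((1 - v) / (1 - u)).
  have := lnge ((1 - v) / (1 - u)); rewrite divr_gt0; [|lra|lra].
  by move=> /(_ isT); congr (_ <= _); field; lra.
have A0 : 0 < ln (v / u) by rewrite ln_gt0 // ltr_pdivlMr // mul1r.
have B0 : ln ((1 - v) / (1 - u)) < 0.
  by rewrite ln_lt0 // divr_gt0 ?ltr_pdivrMr; lra.
rewrite ler_pdivrMr in lnA; last by lra.
rewrite ler_pdivrMr in lnB; last by lra.
move: (ln (v / u)) (ln ((1 - v) / (1 - u))) lnA lnB A0 B0 => A B lnA lnB A0 B0.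
have : 0 < (r - v) * (A - B) by apply: mulr_gt0; lra.
lra.
Qed.

(** The capital process for the likelihood ratio of the frequencies
    [u.+1 / d] and [u / d] of [x]. *)
Lemma bit_count_le_ratio (x : bool) (u d : nat) (r : R) :
  (0 < u)%N -> (u.+1 < d)%N ->
  (forall p, lower I <= p <= upper I ->
     (if x then p else 1 - p) * d%:R <= u%:R) ->
  u%:R + 1 < r * d%:R -> r < 1 ->
  \forall n \near \oo,
    bit_count R sigma w x n <= r * selected_count R sigma n.
Proof.
move=> u0' ud' Iq ur r1; have /and3P[l0 lu u1] := interval_forecastP I.
have u0 : 0 < u%:R :> R by rewrite ltr0n.
have vE : u.+1%:R = u%:R + 1 :> R by rewrite natr1.
have ud : u%:R + 1 < d%:R :> R by rewrite -vE ltr_nat.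
have d0 : 0 < d%:R :> R by lra.
(* The likelihood ratios [(u + 1) / u] and [(d - u - 1) / (d - u)] are brought to the common
   denominator [D]. *)
pose wa := (u.+1 * (d - u))%N; pose wb := ((d - u.+1) * u)%N.
pose D := (u * (d - u))%N.
have wa0 : (0 < wa)%N by rewrite muln_gt0 subn_gt0 /=; lia.
have wb0 : (0 < wb)%N by rewrite muln_gt0 subn_gt0 ud'.
have D0 : (0 < D)%N by rewrite muln_gt0 subn_gt0 u0'; lia.
have dum : (d - u)%:R = d%:R - u%:R :> R by rewrite natrB //; lia.
have dvm : (d - u.+1)%:R = d%:R - (u%:R + 1) :> R by rewrite natrB ?vE //; lia.
pose w1 := if x then wa else wb; pose w2 := if x then wb else wa.
have w10 : (0 < w1)%N by rewrite /w1; case: (x).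
have w20 : (0 < w2)%N by rewrite /w2; case: (x).
pose F := capital R sigma w1 w2 D.
have weights : forall p, lower I <= p <= upper I ->
    p * w1%:R + (1 - p) * w2%:R <= D%:R.
  move=> p pI; have := Iq p pI; have /andP[p1 p2] := pI.
  (* The left side of the conclusion minus the right is exactly [t * d - u]. *)
  have bet (t : R) : t * d%:R <= u%:R -> t * wa%:R + (1 - t) * wb%:R <= D%:R.
    by move=> td; rewrite /wa /wb /D !natrM dum dvm vE; nra.
  rewrite /w1 /w2; case: (x) => pq; first exact: bet.
  by have := bet _ pq; rewrite subKr addrC.
have Fm : \forall n \near \oo,
    F (prefix_of w n) <= selected_count R sigma n + 1.
  apply: moderate; last exact: capital_gt0; last exact: capital_computable.
  by split; [exact: capital_test|exact: capital_supermartingale].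
pose alpha : R := ln (wa%:R / D%:R); pose beta : R := ln (wb%:R / D%:R).
have FE n : F (prefix_of w n) = expR (bit_count R sigma w x n * alpha +
    (selected_count R sigma n - bit_count R sigma w x n) * beta).
  rewrite /F capital_prefix // -bit_countC /w1 /w2 /alpha /beta.
  by case: (x); rewrite // addrC.
have alphaE : alpha = ln (((u%:R + 1) / d%:R) / (u%:R / d%:R)).
  rewrite /alpha /wa /D !natrM dum vE; congr ln; field.
  by rewrite !lt0r_neq0 //; lra.
have betaE : beta = ln ((1 - (u%:R + 1) / d%:R) / (1 - u%:R / d%:R)).
  rewrite /beta /wb /D !natrM dum dvm; congr ln; field.
  by rewrite !lt0r_neq0 //; lra.
(* [c] is the logarithmic growth per selected entry when [x] has frequency exactly [r]; as
   [beta <= alpha], a higher frequency yields at least as much. *)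
pose c := r * alpha + (1 - r) * beta.
have c0 : 0 < c.
  rewrite /c alphaE betaE; apply: kelly_rate_gt0 => //.
  - by rewrite divr_gt0.
  - by rewrite ltr_pM2r ?invr_gt0 //; lra.
  - by rewrite ltr_pdivrMr.
have ab : beta <= alpha.
  rewrite /alpha /beta ler_ln ?posrE ?divr_gt0 ?ltr0n //.
  rewrite ler_pM2r ?invr_gt0 ?ltr0n // ler_nat.
  by rewrite /wb mulnC leq_mul // leq_sub2l.
near=> n; rewrite leNgt; apply/negP => many.
have : F (prefix_of w n) <= selected_count R sigma n + 1 by near: n.
rewrite leNgt => /negP; apply.
apply: lt_le_trans (expR_gt_affine c0 _) _.
  by near: n; move/cvgryPge: count_infty; exact.
rewrite FE ler_expR /c.
have : 0 <= (bit_count R sigma w x n - r * selected_count R sigma n) *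
    (alpha - beta).
  by rewrite mulr_ge0 // subr_ge0 // ltW.
lra.
Unshelve. all: end_near. Qed.

(** The endpoints of [I] may be uncomputable reals; rationals [u / d] and [(u + 1) / d] placed
    between [q] and [r] make the betting weights integers. *)
Lemma bit_count_lt (x : bool) (q r : R) :
  (forall p, lower I <= p <= upper I -> (if x then p else 1 - p) <= q) ->
  q < r -> \forall n \near \oo,
    bit_count R sigma w x n <= r * selected_count R sigma n.
Proof.
move=> Iq qr; have /and3P[l0 lu u1] := interval_forecastP I.
have q0 : 0 <= q.
  have := Iq (upper I); rewrite lu lexx => /(_ isT).
  by case: (x); lra.
have [r1|r1] := leP 1 r.
  near=> n; apply: (@le_trans _ _ (1 * selected_count R sigma n)).
    rewrite mul1r; apply: ler_sum => k _.
    by rewrite ler_piMr // lern1 leq_b1.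
  rewrite ler_wpM2r //; exact: sumr_ge0.
(* Here [(r - q) * d > 3] and [u] is the least integer above [q * d], so
   [u + 1 <= q * d + 2 < r * d]; moreover [u] is positive even when [q = 0]. *)
pose d := (Num.trunc (3 / (r - q))).+1; pose u := (Num.trunc (q * d%:R)).+1.
have qr0 : 0 < r - q by lra.
have d1 : 3 < (r - q) * d%:R.
  have /andP[_] := truncn_itv (divr_ge0 (ler0n R 3) (ltW qr0)).
  by rewrite ltr_pdivrMr // mulrC.
have d0 : 0 < d%:R :> R by rewrite ltr0n.
have /andP[qu1 qu2] := truncn_itv (mulr_ge0 q0 (ltW d0)).
rewrite -/d -/u in qu1 qu2.
have uE : (Num.trunc (q * d%:R))%:R = u%:R - 1 :> R.
  by rewrite /u -natr1 addrK.
rewrite uE in qu1.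
have vE : u.+1%:R = u%:R + 1 :> R by rewrite natr1.
have ur : u%:R + 1 < r * d%:R by lra.
have ud : u%:R + 1 < d%:R :> R.
  by apply: lt_le_trans ur _; rewrite ler_piMl // ltW.
have ud' : (u.+1 < d)%N by rewrite -(ltr_nat R) vE.
apply: (@bit_count_le_ratio x u d) => // p pI.
by apply: le_trans (ltW qu2); rewrite ler_wpM2r ?Iq // ltW.
Unshelve. all: end_near. Qed.

Lemma selected_frequencyE n : selected_frequency R sigma w n =
  bit_count R sigma w true n / selected_count R sigma n.
Proof.
congr (_ / _); apply: eq_bigr => k _.
by case: (w k).
Qed.

Lemma frequency_limits :
  [/\ ((lower I)%:E <=
         limn_einf (fun n => (selected_frequency R sigma w n)%:E))%E,
      (limn_einf (fun n => (selected_frequency R sigma w n)%:E) <=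
         limn_esup (fun n => (selected_frequency R sigma w n)%:E))%E
    & (limn_esup (fun n => (selected_frequency R sigma w n)%:E) <=
         (upper I)%:E)%E].
Proof.
(* Once something has been selected, the frequency is a genuine quotient and the default value 0 no
   longer occurs. *)
have count0 : \forall n \near \oo, 0 < selected_count R sigma n.
  by have /cvgryPgt := count_infty; exact.
split; last 1 first.
- apply/lee_addgt0Pr => e e0; rewrite -EFinD; apply: limn_esup_le_near.
  have := @bit_count_lt true (upper I) (upper I + e).
  move=> /(_ _ _) B; near=> n.
  have S0 : 0 < selected_count R sigma n by near: n.
  rewrite lee_fin selected_frequencyE ler_pdivrMr //.
  near: n; apply: B; last by lra.
  by move=> p /andP[].
(* The limit inferior is treated through the zeros: their probability is at most [1 - lower I], and
   their frequency is 1 minus that of the ones. *)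
- rewrite /limn_einf leeNr -EFinN; apply/lee_addgt0Pr => e e0.
  rewrite -EFinD; apply: limn_esup_le_near.
  have := @bit_count_lt false (1 - lower I) (1 - lower I + e).
  move=> /(_ _ _) B; near=> n.
  have S0 : 0 < selected_count R sigma n by near: n.
  have : bit_count R sigma w false n <=
      (1 - lower I + e) * selected_count R sigma n.
    near: n; apply: B; last by lra.
    by move=> p /andP[]; lra.
  rewrite -[false]/(~~ true) bit_countC lee_fin selected_frequencyE.
  by rewrite lerNl ler_pdivlMr //; nra.
- exact: limn_einf_sup.
Unshelve. all: end_near. Qed.

End Frequencies.

(** * Both notions of randomness keep the capital moderate *)

Theorem corollary29 (R : realType) (w : bitpath) (I : interval_forecast R) :
  (forall A : set (real_process R),
     allowable A -> allowable_random A (stationary I) w ->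
     forall sigma : selection, recursive_selection sigma ->
     @selected_count R sigma n @[n --> \oo] --> +oo ->
     [/\ ((lower I)%:E <=
            limn_einf (fun n => (selected_frequency R sigma w n)%:E))%E,
         (limn_einf (fun n => (selected_frequency R sigma w n)%:E) <=
            limn_esup (fun n => (selected_frequency R sigma w n)%:E))%E
       & (limn_esup (fun n => (selected_frequency R sigma w n)%:E) <=
            (upper I)%:E)%E]) /\
  (schnorr_random (stationary I) w ->
     forall sigma : selection, recursive_selection sigma ->
     @selected_count R sigma n @[n --> \oo] --> +oo ->
     [/\ ((lower I)%:E <=
            limn_einf (fun n => (selected_frequency R sigma w n)%:E))%E,
         (limn_einf (fun n => (selected_frequency R sigma w n)%:E) <=
            limn_esup (fun n => (selected_frequency R sigma w n)%:E))%E
       & (limn_esup (fun n => (selected_frequency R sigma w n)%:E) <=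
            (upper I)%:E)%E]).
Proof.
split=> [A [_ _ A_pos] w_random|w_random] sigma sigma_rec count_infty;
  apply: frequency_limits => // F F_super F_comp F_pos.
(* Positivity and computability put [F] into [A], so [F] is bounded along the path, and the
   selection count eventually exceeds the bound. *)
- have [F_test _] := F_super.
  have := w_random F (A_pos F F_test F_comp F_pos) F_super.
  set s := ereal_sup _ => s_fin.
  have Fs n : (0 < n)%N -> ((F (prefix_of w n))%:E <= s)%E.
    by move=> n0; apply: ereal_sup_ubound; exists n.
  have s_num : s \is a fin_num.
    rewrite fin_numE -!ltey s_fin andbT -ltNye.
    exact: lt_le_trans (ltNyr _) (Fs 1%N isT).
  near=> n; have : ((F (prefix_of w n))%:E <= s)%E.
    by apply: Fs; near: n; exact: nbhs_infty_gt.
  rewrite -(fineK s_num) lee_fin => /le_trans; apply.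
  apply: le_trans (_ : selected_count R sigma n <= _); last by rewrite lerDl.
  by near: n; have /cvgryPge := count_infty; exact.
(* The selection count is used as growth function. A limit superior at most 0 is below 1, so
   eventually [F] is less than the count plus 1. *)
- have rhoE n : (\sum_(0 <= k < n) sigma k)%N%:R = selected_count R sigma n.
    by rewrite natr_sum.
  have rho : growth_function (fun n => \sum_(0 <= k < n) sigma k)%N.
    split; first exact: recursive_count.
      move=> m n mn; by rewrite (big_cat_nat (leq0n m) mn) leq_addr.
    move=> B; have /cvgryPgt /(_ B%:R) [N _ NB] := count_infty.
    by exists N; rewrite -(ltr_nat R) rhoE; exact: NB (leqnn N).
  have := w_random F _ F_super F_comp rho.
  move=> /le_lt_trans /(_ lte01) /limn_esup_lt_near.
  apply: filterS => n; rewrite lte_fin rhoE; lra.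
Unshelve. all: end_near. Qed.
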